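(* Let $\Delta$ be the clique complex of a chordal graph on vertex set $X$, $|X|=N$, with at least two maximal cliques, and let $n_{\max}$ be the largest cardinality of a facet of $\Delta$. Let $\boldsymbol\Delta_{N}$ denote the full simplex on $X$, and let $-1\le k<N-3$. Then $$(\Delta^\vee)_{(k)}=(\boldsymbol\Delta_{N})_{(k)}\quad\Longleftrightarrow\quad k\le N-n_{\max}-2.$$ In this range (i.e. when $k\le N-n_{\max}-2$), $$\beta_{i,i+k+1}\bigl(\mathbb K[(\Delta^\vee)_{(k)}]\bigr)=\binom{N}{i+k+1}\binom{i+k}{k+1}\qquad(i\ge1),$$ and, if $k\ge0$, then $$(\Delta^\vee)_{(k)}\simeq\bigvee^{\binom{N-1}{k+1}}S^k.$$
   Context: $\mathbb K$ is a field and $R=\mathbb K[x:x\in X]$ with the standard grading. A simplicial complex $\Sigma$ on the finite set $X$ is a collection of subsets (faces) of $X$ closed under inclusion; elements of $X$ not lying in any face (ghost vertices) are allowed. Facets are the maximal faces, and a face $F$ has dimension $|F|-1$. The $k$-skeleton $\Sigma_{(k)}$ consists of all faces of dimension at most $k$, viewed as a complex on the same set $X$; $\Sigma_{(-1)}=\{\varnothing\}$. The Alexander dual on $X$ is $\Sigma^\vee=\{F\subseteq X:X\setminus F\notin\Sigma\}$. $I_\Sigma\subseteq R$ is generated by the monomials $\prod_{x\in A}x$ with $A\subseteq X$, $A\notin\Sigma$; $\mathbb K[\Sigma]=R/I_\Sigma$; $\beta_{i,j}$ denotes graded Betti numbers over $R$. The clique complex of a finite graph consists of its cliques; its facets are the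 maximal cliques. $\bigvee^{t}S^k$ is a wedge of $t$ copies of the $k$-sphere. Binomial convention: $\binom ab=0$ if $a<0$, $b<0$ or $b>a$; otherwise it is the usual binomial coefficient. *)

(* Defs.v *)
From HB Require Import structures.
From mathcomp Require Import all_boot all_order all_algebra.
From mathcomp Require mpoly.

Set Implicit Arguments.
Unset Strict Implicit.
Unset Printing Implicit Defensive.

Import Order.TTheory GRing.Theory Num.Theory.
Local Open Scope ring_scope.

Definition binz (a b : int) : nat :=
  match a, b with
  | Posz m, Posz n => 'C(m, n)
  | _, _ => 0%N
  end.

(* A simple graph on X is a symmetric irreflexive e : rel X.  In a cycle s of  *)
(* pairwise distinct vertices, x and next s x are consecutive, and a chord is  *)
(* an edge between two non-consecutive vertices.                               *)
Definition chordal (X : finType) (e : rel X) : Prop :=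
  forall s : seq X, (4 <= size s)%N -> ucycle e s ->
    exists x y, [/\ x \in s, y \in s, e x y, y != next s x & x != next s y].

(* A simplicial complex on X is represented by its set of faces; points of X   *)
(* that lie in no face are allowed.                                            *)
Section Complexes.
Variable X : finType.
Implicit Types (S : {set {set X}}) (F : {set X}).

Definition clique_complex (e : rel X) : {set {set X}} :=
  [set F : {set X} | [forall x in F, forall y in F, (x != y) ==> e x y]].

Definition full_simplex : {set {set X}} := [set: {set X}].

Definition facets S : {set {set X}} := [set F | maxset [pred A | A \in S] F].

Definition skeleton S (k : int) : {set {set X}} :=
  [set F in S | #|F|%:Z - 1 <= k].

Definition alexander_dual S : {set {set X}} := [set F | ~: F \notin S].

End Complexes.

Definition supp (V : nmodType) (X : finType) (p : X -> V) : {set X} :=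
  [set x | p x != 0].

(* mpoly is imported only inside this module because its notations are         *)
(* incompatible with those of the analysis library loaded below.               *)
Module Resolutions.
Import mpoly.

(* The variables of K[x : x in X] are indexed by 'I_#|X| through enum_rank.    *)
Definition face_monomial (K : fieldType) (X : finType) (A : {set X}) :
    {mpoly K[#|X|]} :=
  \prod_(x in A) 'X_(enum_rank x).

Definition SR_ideal (K : fieldType) (X : finType) (S : {set {set X}})
    (f : {mpoly K[#|X|]}) : Prop :=
  exists c : {set X} -> {mpoly K[#|X|]},
    f = \sum_(A : {set X} | A \notin S) c A * face_monomial K A.

Definition homog_of_degree (n : nat) (K : fieldType) (d : int)
    (p : {mpoly K[n]}) : Prop :=
  match d with
  | Posz m => p \is m.-homog
  | Negz _ => p = 0
  end.

(* A graded free resolution of P/I, for P = K[x_1..x_n] and I a homogeneous    *)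
(* ideal, by free modules of finite rank                                       *)
(*   F_i = P(- gr_shift i 0) + ... + P(- gr_shift i (rk i - 1)).               *)
(* Elements of F_i are row vectors and maps act by right multiplication:       *)
(* gr_diff i : F_(i+1) -> F_i, and gr_aug followed by the projection P -> P/I  *)
(* is the augmentation F_0 -> P/I.  All maps have degree 0.                    *)
Record graded_free_resolution (n : nat) (K : fieldType)
    (I : {mpoly K[n]} -> Prop) := GradedFreeResolution {
  gr_rank : nat -> nat;
  gr_shift : forall i, 'I_(gr_rank i) -> int;
  gr_diff : forall i, 'M[{mpoly K[n]}]_(gr_rank i.+1, gr_rank i);
  gr_aug : 'cV[{mpoly K[n]}]_(gr_rank 0);
  gr_diff_homog : forall i a b,
    homog_of_degree (gr_shift a - gr_shift b) (gr_diff i a b);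
  gr_aug_homog : forall a, homog_of_degree (gr_shift a) (gr_aug a 0);
  gr_aug_surj : forall f, exists v : 'rV_(gr_rank 0),
    I (f - (v *m gr_aug) 0 0);
  gr_exact_aug : forall v : 'rV_(gr_rank 0),
    I ((v *m gr_aug) 0 0) <-> exists w, v = w *m gr_diff 0;
  gr_exact_diff : forall i (v : 'rV_(gr_rank i.+1)),
    v *m gr_diff i = 0 <-> exists w, v = w *m gr_diff i.+1
}.

(* The image of each differential lies in (x_1..x_n) F_i; an entry belongs to  *)
(* (x_1..x_n) exactly when its constant coefficient vanishes.                  *)
Definition minimal_resolution (n : nat) (K : fieldType)
    (I : {mpoly K[n]} -> Prop) (F : graded_free_resolution I) : Prop :=
  forall i a b, (gr_diff F i a b)@_0%MM = 0.

Definition num_generators (n : nat) (K : fieldType)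
    (I : {mpoly K[n]} -> Prop) (F : graded_free_resolution I)
    (i : nat) (j : int) : nat :=
  #|[set a : 'I_(gr_rank F i) | gr_shift a == j]|.

End Resolutions.
Export Resolutions.

From mathcomp Require Import all_classical all_reals all_analysis homotopy.
Import numFieldNormedType.Exports.
Local Open Scope classical_set_scope.

(* The graded Betti number beta_(i,j) of P/I: the number of generators of      *)
(* degree j in homological degree i of a chosen minimal graded free            *)
(* resolution of P/I (the default 0 is used only if there is none).            *)
Definition betti (n : nat) (K : fieldType) (I : mpoly.mpoly n K -> Prop)
    (i : nat) (j : int) : nat :=
  xget 0%N [set b | exists F : graded_free_resolution I,
                      minimal_resolution F /\ b = num_generators F i j].

(* Topological spaces are considered over an arbitrary model R of the reals;   *)
(* subsets carry the subspace topology of set_type.                            *)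
Definition geometric_realization (R : realType) (X : finType)
    (S : {set {set X}}) : topologicalType :=
  [set p : {ptws X -> R} |
    [/\ forall x, 0 <= p x, \sum_x p x = 1 & supp p \in S]].

Definition sphere_set (R : realType) (d : nat) : set 'rV[R]_d.+1 :=
  [set v | \sum_i v 0 i ^+ 2 = 1].
Arguments sphere_set : clear implicits.

Definition sphere (R : realType) (d : nat) : topologicalType := sphere_set R d.

Lemma sphere_base_subproof (R : realType) (d : nat) :
  delta_mx 0 0 \in sphere_set R d.
Proof.
apply/mem_set; rewrite /sphere_set /= (bigD1 ord0) //= big1 ?addr0.
  by rewrite mxE !eqxx expr1n.
by move=> i /negbTE ni; rewrite mxE ni andbF expr0n.
Qed.

Definition sphere_base (R : realType) (d : nat) : sphere R d :=
  exist _ (delta_mx 0 0) (sphere_base_subproof R d).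

(* With t = 0 the library's wedge is empty rather than a point.                *)
Definition sphere_wedge (R : realType) (t d : nat) : topologicalType :=
  wedge (fun _ : 'I_t => sphere_base R d).

Definition homotopic (R : realType) (T U : topologicalType) (f g : T -> U) :
    Prop :=
  exists H : R * T -> U,
    [/\ {within `[0, 1]%classic `*` setT, continuous H},
        forall x, H (0, x) = f x & forall x, H (1, x) = g x].

Definition homotopy_equivalent (R : realType) (T U : topologicalType) : Prop :=
  exists (f : T -> U) (g : U -> T),
    [/\ continuous f, continuous g,
        homotopic R (g \o f) idfun & homotopic R (f \o g) idfun].

(* Main.v *)
Require Import Defs.
From mathcomp Require Import all_boot all_order all_algebra reals.
From mathcomp Require Import lra ring zify.
From mathcomp Require mpoly boolp.
Set Implicit Arguments.
Unset Strict Implicit.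
Unset Printing Implicit Defensive.
Import Order.TTheory GRing.Theory Num.Theory.
Local Open Scope ring_scope.

(** A set is missing from the Alexander dual of [Delta] exactly when its complement
    is a face of [Delta].  So the dual contains all sets of at most [k + 1] points
    iff [Delta] has no face with [N - k - 1] points or more, and this can be read
    off from a largest facet ([dual_skeleton_full]).  In that range the complex is
    the [k]-skeleton of the simplex on [X], and the two other claims are about
    this skeleton.

    Betti numbers.  The Stanley-Reisner ideal is the ideal [I(N, d)] of all
    squarefree monomials of degree [d = k + 2] in [N] variables
    ([SR_ideal_sqfree]).  Singling out a variable [x] gives
    [I(N+1, d+1) = I(N, d+1) + x I(N, d)], where the two summands meet in
    [x I(N, d+1)].  Hence a mapping cone resolves [I(N+1, d+1)] once [I(N, d+1)]
    and [I(N, d)] are resolved ([linear_resolution_cone]).  By induction all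
    matrices consist of linear forms, so the resolution is minimal, and the
    recursion for the ranks is solved by [C(N, i + d) C(i + d - 1, i)]
    ([sqfree_resolution]).  The Betti numbers are read off from an arbitrary
    minimal resolution, so one also needs that two of them agree in the number of
    generators of each degree ([eq_num_generators]): they are linked by homogeneous
    comparison maps, the composites of which are homotopic to the identity, and the
    homotopy disappears modulo the variables.

    Homotopy type.  Fix a vertex [x0].  Each point of the skeleton lies in the
    boundary of the simplex spanned by [x0] and some set [F] of [k + 1] other
    points.  There are [C(N - 1, k + 1)] such sets, each of these boundaries is a
    [k]-sphere through [x0], and collapsing everything but the interiors of the sets
    [F] to [x0] yields the wedge of the spheres.  Two explicit maps on nonnegative
    vectors turn this into formulas.  [push] moves a point of the skeleton towards
    [x0], all the way unless the point is interior to some [F], in which case the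
    depth in [F] decides how far.  [retract] subtracts the [k+2]-nd largest
    coordinate, cuts off at zero and rescales, which leads back to the skeleton.
    The map to the wedge is [push] followed by coordinates on the spheres, the map
    back is the inverse of these coordinates on each sphere, and both homotopies are
    a gradual [push] followed by a projection.  That the projections are defined
    along the way is [push_nonconst]. *)

(** * Full skeleta of an Alexander dual *)

Section DualSkeleton.
Variables (X : finType) (D : {set {set X}}).
Implicit Types F G : {set X}.

Definition max_facet_card : nat := (\max_(F in facets D) #|F|)%N.

Lemma card_face_leq F : F \in D -> (#|F| <= max_facet_card)%N.
Proof.
move=> FD; have [G maxG FG] := @maxset_exists _ [pred A | A \in D] F FD.
apply: leq_trans (subset_leq_card FG) _.
by apply: leq_bigmax_cond; rewrite inE.
Qed.

Lemma max_facet_card_attained : facets D != set0 ->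
  exists2 F, F \in D & #|F| = max_facet_card.
Proof.
case/set0Pn => F0 F0D; rewrite /max_facet_card.
have [|F FD ->] := @eq_bigmax_cond _ (mem (facets D)) (fun F => #|F|).
  by apply/card_gt0P; exists F0.
by exists F => //; move: FD; rewrite inE => /maxsetp.
Qed.

(** If a largest facet [G] has at least [N - n] points, then its complement has
    at most [n] points and is missing from the dual.  Conversely a set of at
    most [n] points that is missing from the dual has a face as complement. *)
Lemma dual_skeleton_full (n : nat) : facets D != set0 ->
  skeleton (alexander_dual D) (n%:Z - 1) = skeleton (full_simplex X) (n%:Z - 1)
  <-> (n + max_facet_card < #|X|)%N.
Proof.
move=> D0; split=> [eqsk|nX].
  rewrite ltnNge; apply/negP => Xn; have [G GD Gmax] := max_facet_card_attained D0.
  have : ~: G \in skeleton (full_simplex X) (n%:Z - 1).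
    by rewrite !inE /=; have := cardsC G; lia.
  by rewrite -eqsk !inE setCK GD.
apply/setP => F; rewrite !inE /= andbC; apply: andb_idr => Fn.
apply/negP => /card_face_leq; have := cardsC F; move: nX Fn; lia.
Qed.

Lemma mem_skeleton_full (n : nat) F :
  (F \in skeleton (full_simplex X) (n%:Z - 1)) = (#|F| <= n)%N.
Proof. by rewrite !inE /=; lia. Qed.

End DualSkeleton.

(** * Chain maps and homotopies *)

Module SquarefreeVeronese.
Import mpoly.

Section Lifting.
Variable P : comNzRingType.

Lemma lift_rows (m p q : nat) (M : 'M[P]_(m, q)) (D : 'M[P]_(p, q)) :
  (forall a, exists w : 'rV_p, row a M = w *m D) -> exists W, M = W *m D.
Proof.
move=> /fin_all_exists[w wE]; exists (\matrix_a w a).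
by apply/row_matrixP => a; rewrite row_mul rowK wE.
Qed.

Lemma mulmx_eq0_rows (p q r : nat) (D : 'M[P]_(p, q)) (D' : 'M[P]_(q, r)) :
  (forall v : 'rV_q, (exists w, v = w *m D) -> v *m D' = 0) -> D *m D' = 0.
Proof.
move=> DD'; apply/row_matrixP => a; rewrite row_mul row0; apply: DD'.
by exists (delta_mx 0 a); rewrite -rowE.
Qed.

Lemma lift_kernel (m p q r : nat) (M : 'M[P]_(m, q)) (D : 'M[P]_(p, q))
    (D' : 'M[P]_(q, r)) :
  (forall v : 'rV_q, v *m D' = 0 -> exists w, v = w *m D) -> M *m D' = 0 ->
  exists W, M = W *m D.
Proof.
move=> exD MD0; apply: lift_rows => a; apply: exD.
by rewrite -row_mul MD0 row0.
Qed.

Variables (rF rG : nat -> nat).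
Variable dF : forall i, 'M[P]_(rF i.+1, rF i).
Variable dG : forall i, 'M[P]_(rG i.+1, rG i).
Hypothesis dFdF : forall i, dF i.+1 *m dF i = 0.
Hypothesis exG :
  forall i (v : 'rV_(rG i.+1)), v *m dG i = 0 -> exists w, v = w *m dG i.+1.

Let liftable i (f : 'M[P]_(rF i, rG i)) := exists f', dF i *m f = f' *m dG i.

(** Each [f i.+1] is chosen together with the fact that [dF i.+1 *m f i.+1] lifts
    along [dG i.+1], so that the next choice needs nothing but the previous one. *)
Lemma lift_chain_map (f0 : 'M_(rF 0, rG 0)) :
  (exists f', dF 0 *m f0 = f' *m dG 0) ->
  exists2 f : forall i, 'M_(rF i, rG i),
    f 0%N = f0 & forall i, dF i *m f i = f i.+1 *m dG i.
Proof.
move=> lf0.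
have step i (f : {f | @liftable i f}) :
    {f' : {f' | @liftable i.+1 f'} | dF i *m sval f = sval f' *m dG i}.
  case: f => f lf /=; apply: boolp.cid; case: lf => f' ff'.
  suff lf' : liftable f' by exists (exist _ f' lf').
  apply: (@lift_kernel _ _ _ _ _ _ (dG i)) => //.
    exact: exG.
  by rewrite -mulmxA -ff' mulmxA dFdF mul0mx.
pose f := nat_rect (fun i => {f | @liftable i f}) (exist _ f0 lf0)
  (fun i g => sval (step i g)).
exists (fun i => sval (f i)) => // i; exact: (svalP (step i (f i))).
Qed.

End Lifting.

Section Homotopy.
Variable P : comNzRingType.
Variables (r : nat -> nat) (d : forall i, 'M[P]_(r i.+1, r i)).
Hypothesis dd : forall i, d i.+1 *m d i = 0.
Hypothesis exd :
  forall i (v : 'rV_(r i.+1)), v *m d i = 0 -> exists w, v = w *m d i.+1.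

(** A chain endomorphism [u] that factors through the image of [d 0] in degree
    zero is null-homotopic, by the usual recursion: with [u i.+1] equal to
    [d i h_i + h_(i+1) d i.+1], the only information needed about [h_i] is
    that [u i - h_i d i] is killed by [d i]. *)
Lemma null_homotopy (u : forall i, 'M_(r i)) :
  (forall i, d i *m u i = u i.+1 *m d i) -> (exists h, u 0%N = h *m d 0) ->
  forall i, exists h h', u i.+1 = d i *m h + h' *m d i.+1.
Proof.
move=> ud u0.
have lift i h : d i *m (u i - h *m d i) = 0 ->
    exists h', u i.+1 - d i *m h = h' *m d i.+1.
  move=> uh0; apply: (@lift_kernel P _ _ _ _ _ _ (d i)).
    exact: exd.
  by rewrite mulmxBl -ud -mulmxA -mulmxBr.
have ex i : exists h, d i *m (u i - h *m d i) = 0.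
  elim: i => [|i [h uh0]].
    by case: u0 => h ->; exists h; rewrite subrr mulmx0.
  have [h' h'E] := lift i h uh0; exists h'.
  by rewrite -h'E subKr mulmxA dd mul0mx.
move=> i; have [h uh0] := ex i; have [h' h'E] := lift i h uh0.
by exists h, h'; rewrite -h'E addrC subrK.
Qed.

End Homotopy.

(** * Homogeneous components of matrices *)

Section Degrees.
Variables (n : nat) (K : fieldType).
Local Notation P := {mpoly K[n]}.
Implicit Types (p q : P) (d e : int).

(** Degrees are integers because an entry of a graded map between free modules
    has the difference of two shifts as its degree. *)
Definition homog_part d p : P :=
  match d with Posz m => pihomog mdeg m p | Negz _ => 0 end.

Lemma mcoeff_pihomog m p u :
  (pihomog mdeg m p)@_u = if mdeg u == m then p@_u else 0.
Proof.
rewrite pihomogE raddf_sum /=.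
under eq_bigr do rewrite mcoeffZ mcoeffX.
case: ifP => um.
  case: (boolP (u \in msupp p)) => [up|up].
    rewrite big_mkcond (bigD1_seq u) ?msupp_uniq //= um eqxx mulr1 big1 ?addr0 //.
    by move=> v /negbTE vu; rewrite vu mulr0 if_same.
  rewrite (memN_msupp_eq0 up) big_seq_cond big1 // => v /andP[vp _].
  by case: (v =P u) vp => [->|_ _]; rewrite ?(negbTE up) // mulr0.
by rewrite big1 // => v vm; case: (v =P u) vm => [->|_ _]; rewrite ?um // mulr0.
Qed.

Lemma mcoeff_homog_part d p u :
  (homog_part d p)@_u = if (mdeg u)%:Z == d then p@_u else 0.
Proof. by case: d => m; rewrite /homog_part ?mcoeff_pihomog ?mcoeff0. Qed.

Lemma homog_of_degreeP d p :
  homog_of_degree d p <-> forall u, (mdeg u)%:Z != d -> p@_u = 0.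
Proof.
case: d => m /=; split.
- by move=> hp u um; apply: (dhomog_nemf_coeff hp).
- move=> hp; apply/dhomogP => u; rewrite mcoeff_msupp; apply: contraNeq => um.
  by rewrite hp.
- by move=> -> u _; rewrite mcoeff0.
- by move=> hp; apply/mpolyP => u; rewrite mcoeff0 hp.
Qed.

Lemma homog_part_homog d p : homog_of_degree d (homog_part d p).
Proof.
by apply/homog_of_degreeP => u ud; rewrite mcoeff_homog_part (negbTE ud).
Qed.

Lemma homog_partD d p q : homog_part d (p + q) = homog_part d p + homog_part d q.
Proof.
by apply/mpolyP => u; rewrite mcoeffD !mcoeff_homog_part; case: ifP; rewrite ?mcoeffD ?addr0.
Qed.

Lemma homog_part0 d : homog_part d 0 = 0 :> P.
Proof. by apply/mpolyP => u; rewrite mcoeff_homog_part mcoeff0 if_same. Qed.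

Lemma homog_partN d p : homog_part d (- p) = - homog_part d p.
Proof.
by apply/mpolyP => u; rewrite mcoeffN !mcoeff_homog_part; case: ifP; rewrite ?mcoeffN ?oppr0.
Qed.

Lemma homog_part_sum d (I : finType) (F : I -> P) :
  homog_part d (\sum_i F i) = \sum_i homog_part d (F i).
Proof. exact: (big_morph _ (homog_partD d) (homog_part0 d)). Qed.

Lemma homog_partMr d e p q : homog_of_degree e q ->
  homog_part (d + e) (p * q) = homog_part d p * q.
Proof.
move=> /homog_of_degreeP hq; apply/mpolyP => u.
rewrite mcoeff_homog_part !mcoeffM -mulrb -sumrMnl; apply: eq_bigr => k /eqP uk.
have -> : (mdeg u)%:Z = (mdeg k.1)%:Z + (mdeg k.2)%:Z.
  by rewrite -PoszD -mdegD -uk.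
rewrite mcoeff_homog_part.
case: (eqVneq ((mdeg k.2)%:Z) e) => [<-|/hq ->]; last by rewrite !mulr0 mul0rn.
by rewrite (can_eq (addrK _)); case: ifP; rewrite ?mulr0n ?mul0r.
Qed.

Lemma homog_partMl d e p q : homog_of_degree e p ->
  homog_part (e + d) (p * q) = p * homog_part d q.
Proof. by move=> hp; rewrite mulrC addrC homog_partMr // mulrC. Qed.

Lemma homog_part_id d p : homog_of_degree d p -> homog_part d p = p.
Proof.
move=> /homog_of_degreeP hp; apply/mpolyP => u; rewrite mcoeff_homog_part.
by case: ifPn => // /hp.
Qed.

Section Matrices.
Variables (a b c : nat) (s : 'I_a -> int) (t : 'I_b -> int) (w : 'I_c -> int).

Definition homog_mx (k l : nat) (s : 'I_k -> int) (t : 'I_l -> int)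
    (M : 'M[P]_(k, l)) :=
  forall i j, homog_of_degree (s i - t j) (M i j).

(** The part of degree zero of a map between graded free modules with shifts
    [s] and [t].  Any chain map between complexes of homogeneous matrices can be
    replaced by its homogenization. *)
Definition homogenize (k l : nat) (s : 'I_k -> int) (t : 'I_l -> int)
    (M : 'M[P]_(k, l)) :=
  \matrix_(i, j) homog_part (s i - t j) (M i j).

Lemma homogenize_homog M : homog_mx s t (homogenize s t M).
Proof. by move=> i j; rewrite mxE; apply: homog_part_homog. Qed.

Lemma homogenizeMr (M : 'M_(a, b)) (D : 'M_(b, c)) : homog_mx t w D ->
  homogenize s w (M *m D) = homogenize s t M *m D.
Proof.
move=> hD; apply/matrixP => i j; rewrite !mxE homog_part_sum.
apply: eq_bigr => l _; rewrite mxE -(homog_partMr _ _ (hD l j)).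
by rewrite addrA subrK.
Qed.

Lemma homogenizeMl (D : 'M_(a, b)) (M : 'M_(b, c)) : homog_mx s t D ->
  homogenize s w (D *m M) = D *m homogenize t w M.
Proof.
move=> hD; apply/matrixP => i j; rewrite !mxE homog_part_sum.
apply: eq_bigr => l _; rewrite mxE -(homog_partMl _ _ (hD i l)).
by rewrite addrA subrK.
Qed.

End Matrices.

End Degrees.

Section ConstantTerms.
Variables (n : nat) (K : fieldType).
Local Notation P := {mpoly K[n]}.

Definition const_part (a b : nat) (M : 'M[P]_(a, b)) : 'M[K]_(a, b) :=
  map_mx (mcoeff 0%MM) M.

Lemma const_part_eq0 a b (s : 'I_a -> int) (t : 'I_b -> int) M i j :
  homog_mx s t M -> s i != t j -> const_part M i j = 0.
Proof.
move=> /(_ i j)/homog_of_degreeP hM st; rewrite mxE hM // mdeg0.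
by rewrite eq_sym subr_eq0.
Qed.

(** The constant part of a map of degree zero only connects generators of the
    same degree, so that a one-sided inverse can be cut down to the generators of
    degree [j] and rank bounds apply there. *)
Lemma leq_card_shift a b (s : 'I_a -> int) (t : 'I_b -> int)
    (A : 'M[K]_(a, b)) (B : 'M[K]_(b, a)) j :
  (forall i l, s i != t l -> A i l = 0) -> A *m B = 1%:M ->
  (#|[set i | s i == j]| <= #|[set l | t l == j]|)%N.
Proof.
move=> A0 AB.
set S := [set i | s i == j]; set T := [set l | t l == j].
pose A' := \matrix_(x < #|S|, y < #|T|) A (enum_val x) (enum_val y).
pose B' := \matrix_(y < #|T|, x < #|S|) B (enum_val y) (enum_val x).
apply: (@mulmx1_min _ _ _ A' B'); apply/matrixP => x y.
have /matrixP/(_ (enum_val x) (enum_val y)) := AB.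
rewrite !mxE (inj_eq enum_val_inj) => <-.
rewrite [RHS](bigID (mem T)) /= [X in _ + X]big1 ?addr0; last first.
  move=> l; rewrite inE => tl; rewrite A0 ?mul0r //.
  by have := enum_valP x; rewrite inE => /eqP ->; rewrite eq_sym.
by rewrite [RHS]big_enum_val; apply: eq_bigr => z _; rewrite !mxE.
Qed.

End ConstantTerms.

(** * Uniqueness of graded Betti numbers *)

Section Uniqueness.
Variables (n : nat) (K : fieldType) (I : {mpoly K[n]} -> Prop).
Hypothesis ID : forall f g, I f -> I g -> I (f + g).
Hypothesis IN : forall f, I f -> I (- f).
Hypothesis IM : forall f g, I g -> I (f * g).
Hypothesis I0 : I 0.
Implicit Types F G : graded_free_resolution I.

Lemma gr_diffK F i : gr_diff F i.+1 *m gr_diff F i = 0.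
Proof. by apply: mulmx_eq0_rows => v /gr_exact_diff. Qed.

Lemma gr_exact_rows F m (M : 'M_(m, gr_rank F 0)) :
  (forall a, I ((M *m gr_aug F) a 0)) -> exists W, M = W *m gr_diff F 0.
Proof.
move=> IMa; apply: lift_rows => a; apply/gr_exact_aug.
by rewrite -row_mul mxE.
Qed.

Lemma gr_diff_aug F a : I ((gr_diff F 0 *m gr_aug F) a 0).
Proof.
have : I ((row a (gr_diff F 0) *m gr_aug F) 0 0).
  by apply/gr_exact_aug; exists (delta_mx 0 a); rewrite -rowE.
by rewrite -row_mul mxE.
Qed.

Lemma I_mulmx m p (M : 'M_(m, p)) (v : 'cV_p) a :
  (forall b, I (v b 0)) -> I ((M *m v) a 0).
Proof.
by move=> Iv; rewrite mxE; apply: (big_ind I) => // b _; apply: IM.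
Qed.

Hypothesis IH : forall d f, I f -> I (homog_part d f).

(** Lifting is done without regard to degrees and the result is homogenized
    afterwards.  In homological degree zero this keeps the compatibility with the
    augmentations because the ideal contains the homogeneous components of its
    elements. *)
Lemma resolution_comparison F G :
  exists f : forall i, 'M_(gr_rank F i, gr_rank G i),
    [/\ forall i, gr_diff F i *m f i = f i.+1 *m gr_diff G i,
        forall i, homog_mx (@gr_shift _ _ _ F i) (@gr_shift _ _ _ G i) (f i) &
        forall a, I ((gr_aug F - f 0%N *m gr_aug G) a 0)].
Proof.
have /fin_all_exists[v vE] a := gr_aug_surj G (gr_aug F a 0).
pose f0 := \matrix_a v a.
have f0E a : I ((gr_aug F - f0 *m gr_aug G) a 0).
  have := vE a; congr I; rewrite [RHS]mxE [X in _ = _ + X]mxE; congr (_ - _).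
  by rewrite -[v a](rowK v) -row_mul mxE.
have lf0 : exists f', gr_diff F 0 *m f0 = f' *m gr_diff G 0.
  apply: gr_exact_rows => a; rewrite -mulmxA -[f0 *m _](subKr (gr_aug F)).
  rewrite mulmxBr mxE; apply: ID; first exact: gr_diff_aug.
  by rewrite mxE; apply: IN; apply: I_mulmx.
have exG i := fun v => proj1 (@gr_exact_diff _ _ _ G i v).
have [f f_0 fd] := lift_chain_map (gr_diffK F) exG lf0.
exists (fun i => homogenize (@gr_shift _ _ _ F i) (@gr_shift _ _ _ G i) (f i)).
split=> [i|i|a].
- rewrite -(homogenizeMl _ _ (@gr_diff_homog _ _ _ F i)) fd.
  by rewrite (homogenizeMr _ _ (@gr_diff_homog _ _ _ G i)).
- exact: homogenize_homog.
pose z (_ : 'I_1) : int := 0.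
have augh (H : graded_free_resolution I) : homog_mx (@gr_shift _ _ _ H 0) z (gr_aug H).
  by move=> b c; rewrite subr0 ord1; apply: gr_aug_homog.
rewrite f_0 -(homogenizeMr _ _ (augh G)).
have := IH (gr_shift a) (f0E a); congr I.
by rewrite !mxE homog_partD homog_partN (homog_part_id (gr_aug_homog a)) subr0.
Qed.

(** The round trip from [F] to [G] and back is homotopic to the identity, and for
    minimal [F] both terms of the homotopy vanish modulo the variables: there
    the round trip is the identity, so [F] is a retract of [G]. *)
Lemma leq_num_generators F G i j : (0 < i)%N -> minimal_resolution F ->
  (num_generators F i j <= num_generators G i j)%N.
Proof.
case: i => // i _ minF.
have [f [fd fh fa]] := resolution_comparison F G.
have [g [gd gh ga]] := resolution_comparison G F.
have exF k := fun v => proj1 (@gr_exact_diff _ _ _ F k v).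
pose u k := f k *m g k - 1%:M.
have ud k : gr_diff F k *m u k = u k.+1 *m gr_diff F k.
  by rewrite mulmxBr mulmxBl mulmxA fd -mulmxA gd mulmxA mulmx1 mul1mx.
have u0 : exists h, u 0%N = h *m gr_diff F 0.
  apply: gr_exact_rows => a.
  have -> : u 0%N *m gr_aug F = - (gr_aug F - f 0%N *m gr_aug G) -
     f 0%N *m (gr_aug G - g 0%N *m gr_aug F).
    by rewrite mulmxBl mul1mx -mulmxA mulmxBr !opprB [RHS]addrC addrA subrK.
  rewrite mxE; apply: ID; rewrite mxE; apply: IN => //; exact: I_mulmx.
have [h [h' uE]] := null_homotopy (gr_diffK F) exF ud u0 i.
apply: (leq_card_shift (A := const_part (f i.+1)) (B := const_part (g i.+1))).
  by move=> a b; apply: const_part_eq0.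
have minF0 k : const_part (gr_diff F k) = 0.
  by apply/matrixP => a b; rewrite !mxE; apply: minF.
have : const_part (u i.+1) = 0.
  rewrite uE /const_part map_mxD !map_mxM -/(const_part _).
  by rewrite -![map_mx _ (gr_diff F _)]/(const_part _) !minF0 mul0mx mulmx0 addr0.
by rewrite /const_part map_mxB map_mxM map_mx1 => /eqP; rewrite subr_eq0 => /eqP.
Qed.

Lemma eq_num_generators F G i j : (0 < i)%N ->
  minimal_resolution F -> minimal_resolution G ->
  num_generators F i j = num_generators G i j.
Proof. by move=> i0 mF mG; apply/eqP; rewrite eqn_leq !leq_num_generators. Qed.

End Uniqueness.

(** * Linear resolutions and the mapping cone *)

Section LinearResolutions.
Variables (n : nat) (K : fieldType).
Local Notation P := {mpoly K[n]}.
Implicit Types (I J : P -> Prop) (d : nat) (r : nat -> nat).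

(** A resolution of the ideal [I] itself (not of the quotient by it), generated
    in degree [d] and with matrices of linear forms, so that the generators of
    step [i] all have degree [i + d] and no shifts have to be recorded. *)
Definition linear_resolution I d r : Prop :=
  exists (D : forall i, 'M[P]_(r i.+1, r i)) (aug : 'cV[P]_(r 0)),
  [/\ forall i a b, D i a b \is 1.-homog,
      forall a, aug a 0 \is d.-homog,
      forall f, I f <-> exists v : 'rV_(r 0), f = (v *m aug) 0 0,
      forall v : 'rV_(r 0), v *m aug = 0 <-> exists w, v = w *m D 0 &
      forall i (v : 'rV_(r i.+1)), v *m D i = 0 <-> exists w, v = w *m D i.+1].

Lemma linear_resolution_ext I J d r r' : (forall f, I f <-> J f) -> r =1 r' ->
  linear_resolution I d r -> linear_resolution J d r'.
Proof.
move=> eIJ er; have -> : J = I.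
  by apply: boolp.funext => f; apply: boolp.propext; split=> /eIJ.
by have -> : r' = r by apply: boolp.funext => i.
Qed.

Lemma linear_resolution_unit :
  linear_resolution (fun=> True) 0 (fun i => (i == 0)%N : nat).
Proof.
exists (fun=> 0), (const_mx 1); split=> [i a b|a|f|v|i v].
- by rewrite mxE rpred0.
- by rewrite mxE dhomog1.
- by split=> // _; exists f%:M; rewrite mul_scalar_mx !mxE mulr1.
- split=> [v0|[w ->]]; last by rewrite mulmx0 mul0mx.
  exists 0; rewrite mul0mx; apply/rowP => j; move/rowP/(_ 0): v0.
  by rewrite !mxE big_ord1 !ord1 mxE mulr1.
- by rewrite (thinmx0 v) mul0mx; split=> // _; exists 0; rewrite mul0mx.
Qed.

Lemma linear_resolution_zero d : linear_resolution (fun f => f = 0) d (fun=> 0%N).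
Proof.
exists (fun=> 0), 0; split=> [i a b|a|f|v|i v]; rewrite ?mxE ?rpred0 //.
- split=> [->|[v ->]]; last by rewrite mulmx0 mxE.
  by exists 0; rewrite mulmx0 mxE.
- by rewrite (thinmx0 v) mul0mx; split=> // _; exists 0; rewrite mul0mx.
- by rewrite (thinmx0 v) mul0mx; split=> // _; exists 0; rewrite mul0mx.
Qed.

(** The inclusion of the resolved ideals lifts to a chain map of linear forms:
    in step [i] its source is generated in degree [i + d.+1] and its target in
    degree [i + d]. *)
Lemma linear_comparison d rA rB
    (DA : forall i, 'M[P]_(rA i.+1, rA i)) (augA : 'cV[P]_(rA 0))
    (DB : forall i, 'M[P]_(rB i.+1, rB i)) (augB : 'cV[P]_(rB 0)) :
    (forall i a b, DA i a b \is 1.-homog) ->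
    (forall a, augA a 0 \is d.+1.-homog) ->
    (forall i a b, DB i a b \is 1.-homog) ->
    (forall a, augB a 0 \is d.-homog) ->
    (forall i, DA i.+1 *m DA i = 0) -> DA 0%N *m augA = 0 ->
    (forall v : 'rV_(rB 0), v *m augB = 0 -> exists w, v = w *m DB 0%N) ->
    (forall i (v : 'rV_(rB i.+1)), v *m DB i = 0 -> exists w, v = w *m DB i.+1) ->
    (forall a, exists v : 'rV_(rB 0), augA a 0 = (v *m augB) 0 0) ->
  exists f : forall i, 'M_(rA i, rB i),
    [/\ forall i a b, f i a b \is 1.-homog, f 0%N *m augB = augA &
        forall i, DA i *m f i = f i.+1 *m DB i].
Proof.
move=> hDA haugA hDB haugB DADA DAaug exB0 exB augAB.
have [f0 f0E] : exists f0, augA = f0 *m augB.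
  apply: lift_rows => a; have [v vE] := augAB a; exists v.
  by apply/matrixP => ? ?; rewrite !ord1 -vE mxE.
have lf0 : exists f', DA 0%N *m f0 = f' *m DB 0%N.
  by apply: (lift_kernel exB0); rewrite -mulmxA -f0E.
have [f f_0 fd] := lift_chain_map DADA exB lf0.
pose t e r i (a : 'I_(r i)) : int := (i + e)%N.
pose z (_ : 'I_1) : int := 0.
have hD e r (D : forall i, 'M[P]_(r i.+1, r i)) i :
    (forall i a b, D i a b \is 1.-homog) -> homog_mx (@t e r i.+1) (@t e r i) (D i).
  by move=> hD a b; rewrite /t addSn -addn1 PoszD addrC addKr; apply: hD.
have haug e r (aug : 'cV[P]_(r 0)) :
    (forall a, aug a 0 \is e.-homog) -> homog_mx (@t e r 0) z aug.
  by move=> ha a b; rewrite ord1 /t /z subr0; apply: ha.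
exists (fun i => homogenize (@t d.+1 rA i) (@t d rB i) (f i)); split=> [i a b||i].
- have := @homogenize_homog _ _ _ _ (@t d.+1 rA i) (@t d rB i) (f i) a b.
  by rewrite {1}/t addnS -addn1 PoszD addrC addKr.
- rewrite -(homogenizeMr _ _ (haug _ _ _ haugB)) f_0 -f0E.
  apply/matrixP => a b; rewrite !mxE homog_part_id //.
  exact: haug.
- rewrite -(homogenizeMl _ _ (hD _ _ _ i hDA)) fd.
  by rewrite (homogenizeMr _ _ (hD _ _ _ i hDB)).
Qed.

Lemma row_mx_homog p q l e (A : 'M[P]_(p, q)) (B : 'M[P]_(p, l)) :
  (forall a b, A a b \is e.-homog) -> (forall a b, B a b \is e.-homog) ->
  forall a b, row_mx A B a b \is e.-homog.
Proof. by move=> hA hB a b; rewrite mxE; case: splitP. Qed.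

Lemma col_mx_homog p q l e (A : 'M[P]_(p, l)) (B : 'M[P]_(q, l)) :
  (forall a b, A a b \is e.-homog) -> (forall a b, B a b \is e.-homog) ->
  forall a b, col_mx A B a b \is e.-homog.
Proof. by move=> hA hB a b; rewrite mxE; case: splitP. Qed.

Lemma mx0_homog p q e (a : 'I_p) (b : 'I_q) :
  (0 : 'M[P]_(p, q)) a b \is e.-homog.
Proof. by rewrite mxE rpred0. Qed.

Section MappingCone.
Variables (x : P) (I J : P -> Prop) (d : nat) (rA rB : nat -> nat).
Hypothesis x_homog : x \is 1.-homog.
Hypothesis x_neq0 : x != 0.
Hypothesis IJ : forall f, I f -> J f.
Hypothesis xI : forall f, I (x * f) -> I f.
Hypothesis IN : forall f, I f -> I (- f).

Definition shift_rank r i : nat := if i is i'.+1 then r i' else 0.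

(** By [xI] the intersection of [I] and [x J] is [x I], whence an exact sequence
    0 -> I -> I (+) J -> I + x J -> 0 whose first map sends [g] to [(x g, - g)].
    The resolution is the mapping cone of that map: in step [i] it is
    [A_i + B_i + A_(i-1)], with differential sending [(a, b, a')] to
    [(d a + x a', d b - f a', - d a')], where [f] is the lift of the inclusion of
    [I] in [J].  Everything in it is linear when [x] is. *)
Lemma linear_resolution_cone :
  linear_resolution I d.+1 rA -> linear_resolution J d rB ->
  linear_resolution (fun f => exists g h, [/\ I g, J h & f = g + x * h]) d.+1
    (fun i => rA i + rB i + shift_rank rA i)%N.
Proof.
case=> DA [augA [hDA haugA IA exA0 exA]] [DB [augB [hDB haugB JB exB0 exB]]].
have DADA i : DA i.+1 *m DA i = 0 by apply: mulmx_eq0_rows => v /exA.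
have DAaug : DA 0%N *m augA = 0 by apply: mulmx_eq0_rows => v /exA0.
have DBDB i : DB i.+1 *m DB i = 0 by apply: mulmx_eq0_rows => v /exB.
have DBaug : DB 0%N *m augB = 0 by apply: mulmx_eq0_rows => v /exB0.
have augAB a : exists v : 'rV_(rB 0), augA a 0 = (v *m augB) 0 0.
  by apply/JB/IJ/IA; exists (delta_mx 0 a); rewrite -rowE mxE.
have [f [fh f_0 fd]] := linear_comparison hDA haugA hDB haugB DADA DAaug
  (fun v => proj1 (exB0 v)) (fun i v => proj1 (exB i v)) augAB.
pose DA' i : 'M_(rA i, shift_rank rA i) := if i is j.+1 then DA j else 0.
pose D i := block_mx (block_mx (DA i) 0 0 (DB i)) 0
  (row_mx x%:M (- f i)) (- DA' i).
pose aug : 'cV_(rA 0 + rB 0 + 0) := col_mx (col_mx augA (x *: augB)) 0.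
have DE i (a : 'rV_(rA i.+1)) (b : 'rV_(rB i.+1)) (a' : 'rV_(rA i)) :
    row_mx (row_mx a b) a' *m D i =
    row_mx (row_mx (a *m DA i + x *: a') (b *m DB i - a' *m f i)) (- (a' *m DA' i)).
  rewrite mul_row_block mul_row_block mul_mx_row !mulmx0 !addr0 !add0r.
  by rewrite add_row_mx !mulmxN mul_mx_scalar.
have augE (a : 'rV_(rA 0)) (b : 'rV_(rB 0)) (c : 'rV_0) :
    row_mx (row_mx a b) c *m aug = a *m augA + x *: (b *m augB).
  by rewrite !mul_row_col mulmx0 addr0 scalemxAr.
have row_split p q l (v : 'rV[P]_(p + q + l)) :
    exists a b c, v = row_mx (row_mx a b) c.
  by exists (lsubmx (lsubmx v)), (rsubmx (lsubmx v)), (rsubmx v); rewrite !hsubmxK.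
have row_eq0 p q l (a : 'rV[P]_p) (b : 'rV_q) (c : 'rV_l) :
    row_mx (row_mx a b) c = 0 <-> [/\ a = 0, b = 0 & c = 0].
  split=> [|[-> -> ->]]; last by rewrite !row_mx0.
  by rewrite -[0]row_mx0 -[X in row_mx X 0]row_mx0 => /eq_row_mx[/eq_row_mx[]].
exists D, aug; split.
- move=> i; apply: col_mx_homog; apply: row_mx_homog.
  + apply: col_mx_homog; apply: row_mx_homog => //; exact: mx0_homog.
  + exact: mx0_homog.
  + apply: row_mx_homog => a b; rewrite mxE; last by rewrite rpredN; apply: fh.
    exact: rpredMn.
  + by move=> a b; rewrite mxE rpredN /DA'; case: (i) a b => [|j] a b; rewrite ?mxE ?rpred0.
- move=> a; apply: col_mx_homog; last exact: mx0_homog.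
  apply: col_mx_homog => {a} a b; rewrite ord1 // mxE -[X in X.-homog]add1n.
  exact: dhomogM.
- move=> g; split=> [[h [h' [/IA[a ->] /JB[b ->] ->]]]|[v ->]].
    by exists (row_mx (row_mx a b) 0); rewrite augE !mxE.
  have [a [b [c ->]]] := row_split _ _ _ v.
  exists ((a *m augA) 0 0), ((b *m augB) 0 0); rewrite augE !mxE; split=> //.
    by apply/IA; exists a; rewrite mxE.
  by apply/JB; exists b; rewrite mxE.
- move=> v; have [a [b [c ->]]] := row_split _ _ _ v; rewrite augE (thinmx0 c).
  split; last first.
    move=> [w]; have [a1 [b1 [a' ->]]] := row_split _ _ _ w; rewrite DE.
    move=> /eq_row_mx[/eq_row_mx[-> ->] _].
    rewrite mulmxDl mulmxBl -!mulmxA DAaug DBaug f_0 !mulmx0 add0r sub0r.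
    by rewrite scalerN -scalemxAl subrr.
  (* x times the image of b lies in I, hence so does the image of b *)
  move=> ab0; have [a' a'E] : exists a' : 'rV_(rA 0), b *m augB = a' *m augA.
    have /IA[a' a'E] : I ((b *m augB) 0 0).
      apply: xI; have /matrixP/(_ 0 0) := ab0.
      rewrite [LHS]mxE [X in _ + X]mxE [RHS]mxE => /eqP.
      rewrite addrC addr_eq0 => /eqP ->; apply: IN; apply/IA; by exists a.
    by exists a'; apply/matrixP => ? ?; rewrite !ord1.
  have /exB0[b1 b1E] : (b - a' *m f 0%N) *m augB = 0.
    by rewrite mulmxBl a'E -mulmxA f_0 subrr.
  have /exA0[a1 a1E] : (a + x *: a') *m augA = 0.
    by rewrite mulmxDl -scalemxAl -a'E.
  exists (row_mx (row_mx a1 b1) (- a')); rewrite DE -a1E -b1E.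
  rewrite scalerN addrK mulNmx opprK subrK; congr row_mx.
  by apply/rowP; case.
- move=> i v; have [a [b [a' ->]]] := row_split _ _ _ v; rewrite DE.
  split; last first.
    move=> [w]; have [a1 [b1 [a2 ->]]] := row_split _ _ _ w; rewrite DE.
    move=> /eq_row_mx[/eq_row_mx[-> ->] ->]; apply/row_eq0; split.
    + rewrite mulmxDl -mulmxA DADA mulmx0 add0r scalerN -scalemxAl.
      exact: subrr.
    + rewrite mulmxBl -!mulmxA DBDB mulmx0 sub0r mulNmx opprK -fd mulmxA.
      exact: addNr.
    + rewrite mulNmx opprK; case: (i) a2 => [|j] a2 /=; first by rewrite mulmx0.
      by rewrite -mulmxA DADA mulmx0.
  move=> /row_eq0[aE bE a'E].
  (* a' is a boundary: for i > 0 because it is a cycle, and for i = 0 because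
     x times its image under augA vanishes *)
  have [a2 a2E] : exists a2, a' = a2 *m DA i.
    case: i a b a' v aE bE a'E => [|j] a b a' v aE bE a'E; last first.
      by apply/exA/eqP; rewrite -oppr_eq0; apply/eqP.
    apply/exA0; have : x *: (a' *m augA) = 0.
      rewrite scalemxAl -[x *: a'](addKr (a *m DA 0%N)) aE addr0 mulNmx.
      by rewrite -mulmxA DAaug mulmx0 oppr0.
    by move=> /eqP; rewrite scalemx_eq0 (negbTE x_neq0) => /eqP.
  have /exB[b1 b1E] : (b - a2 *m f i.+1) *m DB i = 0.
    by rewrite mulmxBl -mulmxA -fd mulmxA -a2E.
  have /exA[a1 a1E] : (a + x *: a2) *m DA i = 0.
    by rewrite mulmxDl -scalemxAl -a2E.
  exists (row_mx (row_mx a1 b1) (- a2)); rewrite DE -a1E -b1E.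
  by rewrite scalerN addrK !mulNmx !opprK subrK a2E.
Qed.

End MappingCone.
End LinearResolutions.

(** * Resolution of squarefree Veronese ideals *)

Section SquarefreePowers.
Variables (n : nat) (K : fieldType).
Local Notation P := {mpoly K[n]}.
Implicit Types (f g : P) (m : 'X_{1..n}) (s : seq 'I_n) (d : nat).

Definition nvars s m : nat := count (fun y => 0 < m y)%N s.

(** The ideal generated by the squarefree monomials of degree [d] in the variables
    of [s], described through its monomials: this makes closure properties and
    division by other variables immediate. *)
Definition sqfree_ideal s d f : Prop :=
  forall m, m \in msupp f -> (d <= nvars s m)%N.

Lemma leq_nvars s m m' : (forall y, m y <= m' y)%N -> (nvars s m <= nvars s m')%N.
Proof. by move=> mm'; apply: sub_count => y /leq_trans; apply. Qed.

Lemma nvars_addU s x m : x \notin s -> nvars s (m + U_(x))%MM = nvars s m.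
Proof.
move=> xs; apply: eq_in_count => y ys; rewrite mnmDE mnm1E.
by case: eqP ys xs => [<- ->|_ _ _] //; rewrite addn0.
Qed.

Lemma sqfree_idealP s d f :
  sqfree_ideal s d f <-> forall m, (nvars s m < d)%N -> f@_m = 0.
Proof.
split=> sf m; rewrite ?mcoeff_msupp.
  move=> md; apply: memN_msupp_eq0; apply/negP => /sf; by rewrite leqNgt md.
by apply: contraNT; rewrite -ltnNge => /sf ->.
Qed.

Lemma sqfree_ideal0 s d : sqfree_ideal s d 0.
Proof. by move=> m; rewrite msupp0. Qed.

Lemma sqfree_idealD s d f g :
  sqfree_ideal s d f -> sqfree_ideal s d g -> sqfree_ideal s d (f + g).
Proof.
rewrite !sqfree_idealP => sf sg m md; by rewrite mcoeffD sf ?sg ?addr0.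
Qed.

Lemma sqfree_idealN s d f : sqfree_ideal s d f -> sqfree_ideal s d (- f).
Proof. by rewrite !sqfree_idealP => sf m md; rewrite mcoeffN sf ?oppr0. Qed.

Lemma sqfree_idealM s d f g : sqfree_ideal s d g -> sqfree_ideal s d (f * g).
Proof.
move=> sg m /msuppM_le /allpairsP[[m1 m2] /= [_ /sg m2d ->]].
by apply: leq_trans m2d _; apply: leq_nvars => y; rewrite mnmDE leq_addl.
Qed.

Lemma sqfree_ideal_homog_part s d e f : sqfree_ideal s d f -> sqfree_ideal s d (homog_part e f).
Proof.
by rewrite !sqfree_idealP => sf m md; rewrite mcoeff_homog_part sf // if_same.
Qed.

Lemma sqfree_idealZX s d c m : (d <= nvars s m)%N -> sqfree_ideal s d (c *: 'X_[m]).
Proof.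
move=> md; apply/sqfree_idealP => m' m'd; rewrite mcoeffZ mcoeffX.
by case: eqP m'd md => [->|_]; rewrite ?mulr0 // ltnNge => /negbTE ->.
Qed.

(** A monomial with only [d] variables of [s] in it belongs to the left-hand ideal
    through [x], so it is divisible by [x]; all other monomials involve more than
    [d] variables of [s]. *)
Lemma sqfree_ideal_cons s x d f : x \notin s ->
  sqfree_ideal (x :: s) d.+1 f <->
  exists g h, [/\ sqfree_ideal s d.+1 g, sqfree_ideal s d h & f = g + 'X_x * h].
Proof.
move=> xs; split=> [sf|[g [h [sg sh ->]]]]; last first.
  apply: sqfree_idealD => [m /sg /leq_trans|]; first by apply; rewrite leq_addl.
  rewrite mulrC => m; rewrite (perm_mem (msuppMX _ _)) => /mapP[m' /sh m'd ->].
  rewrite addmC /nvars /= mnmDE mnm1E eqxx addn1 add1n ltnS.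
  by rewrite -/(nvars _ _) nvars_addU.
exists (\sum_(m <- msupp f | (d < nvars s m)%N) f@_m *: 'X_[m]).
exists (\sum_(m <- msupp f | ~~ (d < nvars s m)%N) f@_m *: 'X_[m - U_(x)]).
have dec m : m \in msupp f -> ~~ (d < nvars s m)%N ->
    m = ((m - U_(x)) + U_(x))%MM /\ (d <= nvars s m)%N.
  move=> /sf; rewrite /nvars /= -/(nvars s m) -leqNgt => dm md.
  have x0 : (0 < m x)%N.
    by rewrite lt0n; apply: contraTneq dm => ->; rewrite ltnn add0n -ltnNge.
  by split; [rewrite submK // lep1mP -lt0n | move: dm; rewrite x0].
split.
- by apply: big_ind => [||m]; [exact: sqfree_ideal0|exact: sqfree_idealD|exact: sqfree_idealZX].
- rewrite big_seq_cond; apply: big_ind => [||m /andP[mf md]].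
  + exact: sqfree_ideal0.
  + exact: sqfree_idealD.
  + have [mE dm] := dec m mf md; apply: sqfree_idealZX.
    by move: dm; rewrite {1}mE nvars_addU.
- rewrite {1}[f]mpolyE (bigID (fun m => (d < nvars s m)%N)) /=; congr (_ + _).
  rewrite mulr_sumr big_seq_cond [RHS]big_seq_cond; apply: eq_bigr => m /andP[mf md].
  have [mE _] := dec m mf md.
  by rewrite {2}mE mpolyXD -scalerAr mulrC.
Qed.

Lemma sqfree_ideal_divX s x d f :
  x \notin s -> sqfree_ideal s d ('X_x * f) -> sqfree_ideal s d f.
Proof.
move=> xs; rewrite !sqfree_idealP => sf m md.
by rewrite -(mcoeffMX f U_(x)) addmC mulrC sf // nvars_addU.
Qed.

(** For [d = 0] the second factor vanishes unless [i = 0], as it should for the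
    unit ideal. *)
Definition sqfree_rank N d i : nat := 'C(N, i + d) * 'C((i + d).-1, i).

Lemma sqfree_rankS N d i :
  (sqfree_rank N d.+1 i + sqfree_rank N d i + shift_rank (sqfree_rank N d.+1) i)%N
    = sqfree_rank N.+1 d.+1 i.
Proof.
rewrite /sqfree_rank; case: i => [|i] /=; first by rewrite !bin0 !muln1 addn0 binS.
rewrite !addSn !addnS /= !binS -addnA !mulnDl !mulnDr; lia.
Qed.

Lemma sqfree_resolution s d : uniq s ->
  linear_resolution (sqfree_ideal s d) d (sqfree_rank (size s) d).
Proof.
elim: s d => [|x s IHs] [|d] /=.
- move=> _; apply: linear_resolution_ext (linear_resolution_unit n K) => // i.
  by rewrite /sqfree_rank addn0; case: i.
- move=> _; apply: linear_resolution_ext (linear_resolution_zero n K d.+1) => [f|i].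
    split=> [->|/sqfree_idealP f0]; first exact: sqfree_ideal0.
    by apply/mpolyP => m; rewrite f0 ?mcoeff0.
  by rewrite /sqfree_rank addnS.
- move=> _; apply: linear_resolution_ext (linear_resolution_unit n K) => // i.
  by rewrite /sqfree_rank addn0; case: i => [|i]; rewrite ?bin0 //= (@bin_small i) ?muln0.
- move=> /andP[xs us].
  have := @linear_resolution_cone n K 'X_x (sqfree_ideal s d.+1) (sqfree_ideal s d) d
    _ _ _ _ _ _ _ (IHs d.+1 us) (IHs d us).
  move=> res; apply: linear_resolution_ext (res _ _ _ _ _).
  + by move=> f; rewrite sqfree_ideal_cons.
  + by move=> i; rewrite sqfree_rankS.
  + by rewrite dhomogX; apply/eqP/mdeg1.
  + by apply/eqP => /mpolyP/(_ U_(x)%MM)/eqP; rewrite mcoeffX eqxx mcoeff0 oner_eq0.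
  + by move=> f sf m /sf /ltnW.
  + by move=> f; apply: sqfree_ideal_divX.
  + exact: sqfree_idealN.
Qed.

End SquarefreePowers.

(** * Betti numbers of full skeleta *)

Section StanleyReisner.
Variables (K : fieldType) (X : finType) (S : {set {set X}}) (d : nat).
Hypothesis nonfaces : forall A, (A \notin S) = (d <= #|A|)%N.
Local Notation n := #|X|.
Implicit Types (f : {mpoly K[n]}) (m : 'X_{1..n}) (A : {set X}).

Let mon A : 'X_{1..n} := (\sum_(x in A) U_(enum_rank x))%MM.
Let vars m : {set X} := [set x | (0 < m (enum_rank x))%N].

Let face_monomialE A : face_monomial K A = 'X_[mon A].
Proof. by rewrite /face_monomial mprodXE. Qed.

Let monE A x : mon A (enum_rank x) = (x \in A).
Proof.
rewrite mnm_sumE; under eq_bigr do rewrite mnm1E (inj_eq enum_rank_inj).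
have [xA|xA] := boolP (x \in A).
  by rewrite (bigD1 x) //= eqxx big1 // => y /andP[_ /negbTE ->].
by rewrite big1 // => y yA; case: eqP yA xA => // -> ->.
Qed.

Let card_vars m : #|vars m| = nvars (enum 'I_n) m.
Proof.
rewrite /nvars enumT -(card_imset _ enum_rank_inj) cardE /enum_mem size_filter.
apply: eq_count => y /=; apply/imsetP/idP => [[x] /[!inE] ? -> //|my].
by exists (enum_val y); rewrite ?inE enum_valK.
Qed.

(** A monomial lies in the Stanley-Reisner ideal iff the set of its variables is a
    nonface, and the nonfaces are the sets with at least [d] points. *)
Lemma SR_ideal_sqfree f : SR_ideal S f <-> sqfree_ideal (enum 'I_n) d f.
Proof.
split=> [[c ->]|sf].
  apply: big_ind => [||A AS]; [exact: sqfree_ideal0|exact: sqfree_idealD|].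
  apply: sqfree_idealM; rewrite face_monomialE -[X in sqfree_ideal _ _ X]scale1r.
  apply: sqfree_idealZX; rewrite -card_vars.
  apply: leq_trans (_ : #|A| <= _)%N; first by rewrite -nonfaces.
  by apply/subset_leq_card/fintype.subsetP => x xA; rewrite inE monE xA.
have SRD g h : SR_ideal S g -> SR_ideal S h -> SR_ideal S (g + h).
  move=> [c ->] [c' ->]; exists (fun A => c A + c' A).
  by rewrite -big_split; apply: eq_bigr => A _; rewrite mulrDl.
have SR0 : SR_ideal S (0 : {mpoly K[n]}).
  by exists (fun=> 0); rewrite big1 // => A _; rewrite mul0r.
rewrite [f]mpolyE big_seq; apply: big_ind => [||m /sf]; [exact: SR0|exact: SRD|].
rewrite -card_vars => md.
(* the monomial m is a multiple of the face monomial of its own variables *)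
exists (fun A => if A == vars m then f@_m *: 'X_[m - mon A] else 0).
rewrite (bigD1 (vars m)) ?nonfaces //= big1 ?addr0; last first.
  by move=> A /andP[_ /negbTE ->]; rewrite mul0r.
rewrite eqxx face_monomialE -scalerAl -mpolyXD submK //.
apply/mnm_lepP => y; rewrite -(enum_valK y) monE inE.
by case: (m _).
Qed.

Definition sqfree_resolution_rank i : nat :=
  if i is i'.+1 then sqfree_rank n d i' else 1.

(** Putting the polynomial ring in front of the linear resolution resolves the
    quotient.  All entries of the differentials have degree 1 or [d], so they have
    no constant term. *)
Lemma sqfree_graded_resolution : (0 < d)%N ->
  exists F : graded_free_resolution (SR_ideal (K := K) S),
    minimal_resolution F /\
    forall i, num_generators F i.+1 (i + d)%N = sqfree_rank n d i.
Proof.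
move=> d0; have [] := sqfree_resolution K d (enum_uniq 'I_n).
rewrite size_enum_ord => D [aug [hD haug Iaug exa exD]].
pose D' i : 'M[{mpoly K[n]}]_(sqfree_resolution_rank i.+1, sqfree_resolution_rank i)
  := if i is i'.+1 then D i' else aug.
pose sh i (_ : 'I_(sqfree_resolution_rank i)) : int :=
  if i is i'.+1 then (i' + d)%N else 0%N.
have shD i a b : homog_of_degree (@sh i.+1 a - @sh i b) (D' i a b).
  case: i a b => [|i] a b.
    have -> : @sh 1%N a - @sh 0%N b = d by rewrite /sh subr0.
    by rewrite ord1; apply: haug.
  by rewrite /sh addSn -addn1 PoszD addrC addKr; apply: hD.
have augE (v : 'rV[{mpoly K[n]}]_1) : (v *m (1%:M : 'M_1)) 0 0 = v 0 0.
  by rewrite mulmx1.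
have h_aug_homog (a : 'I_1) : homog_of_degree (@sh 0 a) ((1%:M : 'cV[{mpoly K[n]}]_1) a 0).
  by rewrite ord1 mxE /=; apply: dhomog1.
have h_surj f : exists v : 'rV[{mpoly K[n]}]_1,
    SR_ideal S (f - (v *m (1%:M : 'cV_1)) 0 0).
  exists f%:M; rewrite augE mxE subrr; exact/SR_ideal_sqfree/sqfree_ideal0.
have h_exact0 (v : 'rV_1) : SR_ideal S ((v *m (1%:M : 'cV_1)) 0 0) <->
    exists w, v = w *m D' 0%N.
  rewrite augE SR_ideal_sqfree Iaug; split=> [] [w wE]; exists w.
    by apply/rowP => j; rewrite ord1.
  by rewrite wE.
have h_exact i (v : 'rV_(sqfree_resolution_rank i.+1)) :
    v *m D' i = 0 <-> exists w, v = w *m D' i.+1.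
  by case: i v => [|i] v; [apply: exa|apply: exD].
exists (GradedFreeResolution shD h_aug_homog h_surj h_exact0 h_exact).
split=> [[|i] a b /=|i].
- rewrite ord1; apply: (dhomog_nemf_coeff (haug a)).
  suff : mdeg (0%MM : 'X_{1..n}) != d by [].
  by rewrite mdeg0 eq_sym -lt0n.
- apply: (dhomog_nemf_coeff (hD i a b)).
  by suff : mdeg (0%MM : 'X_{1..n}) != 1%N by []; rewrite mdeg0.
- rewrite /num_generators /= -[RHS]card_ord; apply: eq_card => a.
  by rewrite !inE eqxx.
Qed.

Lemma betti_SR_ideal i : (0 < d)%N ->
  betti (SR_ideal (K := K) S) i.+1 (i + d)%N = sqfree_rank n d i.
Proof.
move=> d0; have [F [minF numF]] := sqfree_graded_resolution d0.
have SR f := SR_ideal_sqfree f.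
have uniqF (G : graded_free_resolution (SR_ideal (K := K) S)) : minimal_resolution G ->
    num_generators G i.+1 (i + d)%N = sqfree_rank n d i.
  rewrite -numF => minG; apply: eq_num_generators => //.
  - by move=> f g /SR sf /SR sg; apply/SR/sqfree_idealD.
  - by move=> f /SR sf; apply/SR/sqfree_idealN.
  - by move=> f g /SR sg; apply/SR/sqfree_idealM.
  - exact/SR/sqfree_ideal0.
  - by move=> e f /SR sf; apply/SR/sqfree_ideal_homog_part.
rewrite /betti; case: classical_sets.xgetP => [b _ [G [minG ->]]|].
  exact: uniqF.
move=> /(_ (sqfree_rank n d i)) []; exists F; split=> //; by rewrite numF.
Qed.

End StanleyReisner.
End SquarefreeVeronese.

(** * Retraction onto the skeleton of a simplex *)

Lemma subset_of_card (T : finType) (B : {set T}) n :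
  (n <= #|B|)%N -> exists2 A : {set T}, A \subset B & #|A| = n.
Proof.
move=> nB; have : (0 < 'C(#|B|, n))%N by rewrite bin_gt0.
rewrite -cards_draws => /card_gt0P[A]; rewrite inE => /andP[AB /eqP An].
by exists A.
Qed.

Section Retraction.
Variables (R : realType) (X : finType) (k : nat).
Implicit Types (z p : X -> R) (A B F : {set X}).

(** The sum is a neutral default: it bounds every coordinate of a nonnegative [z],
    and it is homogeneous and continuous in [z]. *)
Definition min_on A z : R := \big[Num.min / (\sum_x z x)]_(x in A) z x.

(** The [k.+2]-nd largest coordinate of a nonnegative [z]; in this form it is
    visibly continuous. *)
Definition level z : R := \big[Num.max/0]_(A : {set X} | #|A| == k.+2) min_on A z.

Definition above_level z x : R := Num.max 0 (z x - level z).

(** Subtracting the [k.+2]-nd largest coordinate leaves at most [k.+1] positive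
    ones.  After rescaling this is a retraction onto the [k]-skeleton, defined for
    all nonnegative [z] whose largest coordinate exceeds the level. *)
Definition retract z x : R := above_level z x / \sum_y above_level z y.

Definition nonneg z := forall x, 0 <= z x.

Lemma min_on_le A z x : x \in A -> min_on A z <= z x.
Proof. exact: bigmin_le_cond. Qed.

Lemma le_sum z x : nonneg z -> z x <= \sum_y z y.
Proof. by move=> z0; rewrite (bigD1 x) //= lerDl sumr_ge0. Qed.

Lemma min_on_ge0 A z : nonneg z -> 0 <= min_on A z.
Proof. by move=> z0; apply: le_bigmin => //; apply: sumr_ge0. Qed.

Lemma min_on_attained A z : nonneg z -> (0 < #|A|)%N ->
  exists2 x, x \in A & min_on A z = z x.
Proof.
move=> z0 /card_gt0P[a aA].
rewrite /min_on; have [|y _|x xA ->] := @eq_bigmin _ _ _ (\sum_x z x) a (mem A) z.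
- exact: aA.
- exact: le_sum.
- by exists x.
Qed.

Lemma min_on_eq0 A z x : nonneg z -> x \in A -> z x = 0 -> min_on A z = 0.
Proof.
by move=> z0 xA zx; apply/le_anti; rewrite min_on_ge0 // -{1}zx min_on_le.
Qed.

Lemma min_on_affine A z z' a s : nonneg z -> nonneg z' -> (0 < #|A|)%N -> 0 < a ->
  (forall x, x \in A -> z' x = a * z x + s) -> min_on A z' = a * min_on A z + s.
Proof.
move=> z0 z'0 A0 a0 zz'; apply/le_anti/andP; split.
  by have [x xA ->] := min_on_attained z0 A0; rewrite -zz' // min_on_le.
have [x xA ->] := min_on_attained z'0 A0.
by rewrite zz' // lerD2r ler_pM2l // min_on_le.
Qed.

Lemma level_ge0 z : 0 <= level z.
Proof. exact: bigmax_ge_id. Qed.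

Lemma min_on_level A z : #|A| = k.+2 -> min_on A z <= level z.
Proof. by move=> Ak; apply: (le_bigmax_cond _ (fun A => min_on A z)); apply/eqP. Qed.

Lemma level_supported B z : nonneg z -> #|B| = k.+2 ->
  (forall x, x \notin B -> z x = 0) -> level z = min_on B z.
Proof.
move=> z0 Bk zB; apply/le_anti; rewrite min_on_level // andbT.
apply: bigmax_le => [|A /eqP Ak]; first exact: min_on_ge0.
have [->//|AB] := eqVneq A B.
have /subsetPn[x xA xB] : ~~ (A \subset B).
  by apply: contra AB => AB; rewrite eqEcard AB Bk Ak /=.
by rewrite (min_on_eq0 z0 xA (zB x xB)) min_on_ge0.
Qed.

Lemma above_level_ge0 z : nonneg (above_level z).
Proof. by move=> x; rewrite le_max lexx. Qed.

Lemma card_supp_above_level z : nonneg z ->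
  (#|supp (above_level z)| <= k.+1)%N.
Proof.
move=> z0; rewrite leqNgt; apply/negP => /subset_of_card[A /fintype.subsetP AS Ak].
have [|x xA minx] := min_on_attained (A := A) z0; first by rewrite Ak.
have := AS x xA; rewrite inE => /eqP; apply; apply/max_idPl.
by rewrite subr_le0 -minx min_on_level.
Qed.

Definition exceeds_level z := exists x, level z < z x.

Lemma sum_above_level_gt0 z : exceeds_level z -> 0 < \sum_x above_level z x.
Proof.
move=> [x zx]; rewrite (bigD1 x) //= ltr_pwDl ?sumr_ge0 //; last first.
  by move=> y _; apply: above_level_ge0.
by rewrite lt_max subr_gt0 zx orbT.
Qed.

Lemma retract_ge0 z : nonneg (retract z).
Proof.
move=> x; rewrite divr_ge0 ?above_level_ge0 //.
by apply: sumr_ge0 => y _; apply: above_level_ge0.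
Qed.

Lemma sum_retract z : exceeds_level z -> \sum_x retract z x = 1.
Proof.
by move=> /sum_above_level_gt0 t0; rewrite -mulr_suml divff // gt_eqF.
Qed.

Lemma card_supp_retract z : nonneg z -> (#|supp (retract z)| <= k.+1)%N.
Proof.
move=> z0; apply: leq_trans (card_supp_above_level z0); apply: subset_leq_card.
by apply/fintype.subsetP => x; rewrite !inE; apply: contraNneq => xz; rewrite /retract xz mul0r.
Qed.

(** Barycentric coordinates of the points of the [k]-skeleton. *)
Definition simplex_point p := [/\ nonneg p, \sum_x p x = 1 & (#|supp p| <= k.+1)%N].

Lemma retract_simplex z : nonneg z -> exceeds_level z -> simplex_point (retract z).
Proof.
by split; [exact: retract_ge0|exact: sum_retract|exact: card_supp_retract].
Qed.

Lemma retract_id p : simplex_point p -> retract p = p.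
Proof.
move=> [p0 p1 pk]; have l0 : level p = 0.
  apply/le_anti; rewrite level_ge0 andbT; apply: bigmax_le => // A /eqP Ak.
  have /subsetPn[x xA] : ~~ (A \subset supp p).
    by apply: contraL pk => /subset_leq_card; rewrite Ak -ltnNge.
  by rewrite inE negbK => /eqP px; rewrite (min_on_eq0 p0 xA px).
have aE x : above_level p x = p x by rewrite /above_level l0 subr0 max_r.
by apply: boolp.funext => x; rewrite /retract aE (eq_bigr _ (fun y _ => aE y)) p1 divr1.
Qed.

Section Supported.
Variable B : {set X}.
Hypothesis cardB : #|B| = k.+2.

Definition supported z := forall x, x \notin B -> z x = 0.

Lemma above_level_supported z x : nonneg z -> supported z ->
  above_level z x = if x \in B then z x - min_on B z else 0.
Proof.
move=> z0 zB; rewrite /above_level (level_supported z0 cardB zB).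
case: ifPn => xB; first by rewrite max_r // subr_ge0 min_on_le.
by rewrite max_l // zB // sub0r oppr_le0 min_on_ge0.
Qed.

Lemma exceeds_level_supported z x y : nonneg z -> supported z ->
  x \in B -> y \in B -> z x != z y -> exceeds_level z.
Proof.
move=> z0 zB xB yB zxy.
suff [w wB zw] : exists2 w, w \in B & min_on B z < z w.
  by exists w; rewrite (level_supported z0 cardB zB).
have := min_on_le z xB; rewrite le_eqVlt => /predU1P[xE|]; last by exists x.
exists y => //; rewrite lt_neqAle min_on_le // xE zxy //.
Qed.

(** On vectors supported on [k.+2] points the level is the least coordinate, so the
    retraction is radial projection to the boundary of the simplex [B]: it ignores
    translation along the diagonal and scaling. *)
Lemma retract_affine z z' a s : nonneg z -> nonneg z' -> supported z ->
  supported z' -> exceeds_level z -> 0 < a ->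
  (forall x, x \in B -> z' x = a * z x + s) -> retract z' = retract z.
Proof.
move=> z0 z'0 zB z'B zN a0 zz'.
have aE x : above_level z' x = a * above_level z x.
  rewrite !above_level_supported //; case: ifPn; rewrite ?mulr0 // => xB.
  rewrite (min_on_affine (z := z) (a := a) (s := s)) ?cardB // zz' //; ring.
apply: boolp.funext => x; rewrite /retract (eq_bigr _ (fun y _ => aE y)) aE.
rewrite -mulr_sumr invfM mulrACA divff ?mul1r // gt_eqF //.
Qed.

End Supported.

(** * The cone over a facet *)

Section Facet.
Variables (x0 : X) (F : {set X}).
Hypothesis x0F : x0 \notin F.
Hypothesis cardF : #|F| = k.+1.
Local Notation B := (x0 |: F).

Lemma card_cone : #|B| = k.+2.
Proof. by rewrite cardsU1 x0F cardF. Qed.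

(** For [m] the least coordinate of [p] on [F], and [t] running from 0 to 1, this
    moves [p] to [m p + (1 - (k + 1) m) x0].  The end point is [x0] when [p] is not
    interior to [F] ([m = 0]), and it lies on the ray of [p] when [p] is the
    barycentre of [F] ([m = 1 / (k + 1)]). *)
Definition push (m t : R) p x : R :=
  ((1 - t) + t * m) * p x + t * (1 - k.+1%:R * m) * (x == x0)%:R.

Lemma push_ge0 m t p : 0 <= t <= 1 -> 0 <= m -> k.+1%:R * m <= 1 ->
  nonneg p -> nonneg (push m t p).
Proof.
move=> /andP[t0 t1] m0 m1 p0 x; apply: addr_ge0; apply: mulr_ge0 => //.
  by rewrite addr_ge0 ?subr_ge0 ?mulr_ge0.
by rewrite mulr_ge0 ?subr_ge0.
Qed.

Lemma push0 m p : push m 0 p = p.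
Proof.
by apply: boolp.funext => x; rewrite /push subr0 !mul0r !addr0 mul1r.
Qed.

Lemma card_min_on_le1 p : simplex_point p -> k.+1%:R * min_on F p <= 1.
Proof.
move=> [p0 p1 _]; rewrite -[leRHS]p1 (bigID (mem F)) /=.
rewrite -[leLHS]addr0; apply: lerD; last by apply: sumr_ge0 => x _; apply: p0.
rewrite -cardF mulr_natl -sumr_const; apply: ler_sum => x xF; exact: min_on_le.
Qed.

Lemma min_on_gt0_supp p : simplex_point p -> 0 < min_on F p -> supp p = F.
Proof.
move=> [p0 _ pk] m0; apply/esym/eqP; rewrite eqEcard cardF pk andbT.
apply/fintype.subsetP => x xF; rewrite inE gt_eqF //.
exact: lt_le_trans m0 (min_on_le _ xF).
Qed.

(** This is what keeps both homotopies away from the diagonal, where [retract] and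
    the projection to the sphere are undefined.  Let [m] be the least coordinate of
    [p] on [F].  If [m = 0], some coordinate on [F] is 0 after the push; if all of
    them agree with the one at [x0], then that one is 0 too, which happens for
    [t = 0] only and leaves [p = 0].  If [m > 0], then [p] is supported on [F];
    being constant on [F] makes it the barycentre, where the coordinate at [x0]
    is 0 but the others are not. *)
Lemma push_nonconst p t : simplex_point p -> 0 <= t <= 1 ->
  t = 1 \/ supp p \subset B ->
  exists2 x, x \in F & push (min_on F p) t p x != push (min_on F p) t p x0.
Proof.
move=> ps t01 tB; have [p0 p1 _] := ps; apply: boolp.contrapT => nex.
have const x : x \in F -> push (min_on F p) t p x = push (min_on F p) t p x0.
  by move=> xF; apply/eqP; apply: contra_notT nex => neq; exists x.
have F0 : (0 < #|F|)%N by rewrite cardF.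
have x0x x : x \in F -> (x == x0) = false.
  by apply: contraTF => /eqP ->.
move: const; rewrite /push; set m := min_on F p; rewrite eqxx => const.
have [m0|] := eqVneq m 0.
  have [y yF my] := min_on_attained p0 F0.
  have := const y yF; rewrite -my -/m m0 (x0x y yF) !(mulr0, addr0, mulr1, subr0).
  move=> t0; have [|supB] : t = 1 \/ supp p \subset B by [].
    by move=> t1; move: t0; rewrite t1; lra.
  have p00 := p0 x0; have : t = 0 by move: t01; nra.
  move=> t0'; have px00 : p x0 = 0 by move: t0; rewrite t0'; lra.
  have px x : p x = 0.
    have [xB|xB] := boolP (x \in B); last first.
      by have := contra (fintype.subsetP supB x) xB; rewrite inE negbK => /eqP.
    move: xB; rewrite !inE => /predU1P[-> //|xF].
    by have := const x xF; rewrite (x0x x xF) t0' m0 px00; lra.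
  by move: p1; rewrite big1 // => /eqP; rewrite eq_sym oner_eq0.
move=> m0; have {}m0 : 0 < m by rewrite lt_neqAle eq_sym m0 min_on_ge0.
have supF := min_on_gt0_supp ps m0.
have px0 : p x0 = 0.
  by move: x0F; rewrite -supF inE negbK => /eqP.
move: t01 => /andP[t0 t1].
have [y yF my] := min_on_attained p0 F0; rewrite -/m in my.
have a0 : 0 < 1 - t + t * m.
  have [->|tn] := eqVneq t 0; first lra.
  have : 0 < t * m by rewrite mulr_gt0 // lt_neqAle eq_sym tn.
  by move: t1; lra.
have pm x : x \in F -> p x = m.
  move=> xF; have := const x xF; rewrite -(const y yF) (x0x x xF) (x0x y yF) -my.
  by rewrite !mulr0 !addr0; apply: mulfI; rewrite gt_eqF.
have km : k.+1%:R * m = 1.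
  rewrite -[RHS]p1 [RHS](bigID (mem F)) /= [X in _ + X]big1 ?addr0; last first.
    by move=> x; rewrite -supF inE negbK => /eqP.
  by rewrite (eq_bigr _ pm) sumr_const cardF mulr_natl.
have := mulr_gt0 a0 m0; have := const y yF; rewrite (x0x y yF) -my px0 km.
by lra.
Qed.

(** The point [r] of [F] serves as origin: the differences of the other [k.+1]
    coordinates on the cone with the one at [r] identify the boundary of the simplex
    [B], up to positive scaling, with the sphere.  Vertex number 0 is the apex [x0],
    so that the apex corresponds to the base point of the sphere. *)
Definition facet_pt : X := nth x0 (enum F) 0.
Definition facet_vtx (j : 'I_k.+1) : X := nth x0 (x0 :: behead (enum F)) j.
Local Notation r := facet_pt.
Local Notation v := facet_vtx.

Let enumF : enum F = r :: behead (enum F).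
Proof.
by rewrite /facet_pt; have := cardE F; rewrite cardF; case: (enum F).
Qed.

Let size_vtx : size (x0 :: behead (enum F)) = k.+1.
Proof. by rewrite /= size_behead -cardE cardF. Qed.

Let uniq_vtx : uniq (r :: x0 :: behead (enum F)).
Proof.
have := enum_uniq F; rewrite enumF /= inE negb_or => /andP[-> ->] /=.
have := x0F; rewrite -mem_enum enumF inE negb_or => /andP[rx0 ->].
by rewrite eq_sym rx0.
Qed.

Lemma facet_ptF : r \in F.
Proof. by rewrite -mem_enum enumF mem_head. Qed.

Lemma facet_vtx0 : v ord0 = x0. Proof. by []. Qed.

Lemma mem_vtx j : v j \in x0 :: behead (enum F).
Proof. by rewrite mem_nth // size_vtx. Qed.

Lemma facet_vtxB j : v j \in B.
Proof.
have := mem_vtx j; rewrite !inE => /orP[->//|vj].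
by rewrite -(mem_enum F) enumF inE vj !orbT.
Qed.

Lemma facet_vtx_neq j : v j != r.
Proof.
have := uniq_vtx; rewrite cons_uniq => /andP[+ _].
by apply: contraNneq => <-; apply: mem_vtx.
Qed.

Lemma facet_vtx_inj : injective v.
Proof.
have := uniq_vtx; rewrite cons_uniq => /andP[_ u] i j /eqP.
by rewrite nth_uniq ?size_vtx // => /eqP/val_inj.
Qed.

Lemma coneP x : x \in B -> x = r \/ exists j, x = v j.
Proof.
rewrite !inE -(mem_enum F) enumF inE orbCA => /predU1P[->|xv]; first by left.
right; have xv' : x \in x0 :: behead (enum F) by rewrite inE.
have ltx : (index x (x0 :: behead (enum F)) < k.+1)%N.
  by rewrite -size_vtx index_mem.
by exists (Ordinal ltx); rewrite /facet_vtx /= nth_index.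
Qed.

Definition coords z : 'rV[R]_k.+1 := \row_j (z (v j) - z r).

Lemma coords_neq0 z : (exists2 x, x \in F & z x != z x0) -> coords z != 0.
Proof.
move=> [x xF]; apply: contraNneq => c0.
have zv j : z (v j) = z r.
  by move/rowP/(_ j): c0; rewrite !mxE => /eqP; rewrite subr_eq0 => /eqP.
rewrite -[in z x0]facet_vtx0 zv.
have xB : x \in B by rewrite !inE xF orbT.
by have [->|[j ->]] := coneP xB; rewrite ?zv.
Qed.

Lemma coords_neq0_ex z : coords z != 0 -> exists j, z (v j) != z r.
Proof.
move=> c0; apply/existsP; apply: contraNT c0; rewrite negb_exists => /forallP vr.
apply/eqP/rowP => j; rewrite !mxE; have := vr j; rewrite negbK => /eqP ->.
exact: subrr.
Qed.

(** A section of [coords].  The constant 1 makes it nonnegative on the unit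
    sphere. *)
Definition uncoords (w : 'rV[R]_k.+1) x : R :=
  if x \in B then 1 + \sum_j (x == v j)%:R * w 0 j else 0.

Lemma uncoords_vtx w j : uncoords w (v j) = 1 + w 0 j.
Proof.
rewrite /uncoords facet_vtxB (bigD1 j) //= eqxx mul1r big1 ?addr0 // => i ij.
by rewrite (inj_eq facet_vtx_inj) eq_sym (negbTE ij) mul0r.
Qed.

Lemma uncoords_pt w : uncoords w r = 1.
Proof.
rewrite /uncoords inE facet_ptF orbT big1 ?addr0 // => i _.
by rewrite eq_sym (negbTE (facet_vtx_neq i)) mul0r.
Qed.

Lemma coords_uncoords w : coords (uncoords w) = w.
Proof.
by apply/rowP => j; rewrite mxE uncoords_vtx uncoords_pt addrC addKr.
Qed.

Lemma uncoords_supported w : supported B (uncoords w).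
Proof. by move=> x xB; rewrite /uncoords (negbTE xB). Qed.

Lemma uncoords_ge0 (w : 'rV[R]_k.+1) : (forall j, -1 <= w 0 j) -> nonneg (uncoords w).
Proof.
move=> w1 x; have [xB|xB] := boolP (x \in B); last by rewrite uncoords_supported.
have [->|[j ->]] := coneP xB; first by rewrite uncoords_pt.
by rewrite uncoords_vtx -lerBlDl sub0r.
Qed.

Lemma exceeds_level_coords z : nonneg z -> supported B z -> coords z != 0 ->
  exceeds_level z.
Proof.
move=> z0 zB /coords_neq0_ex[j zj].
apply: (exceeds_level_supported card_cone z0 zB (facet_vtxB j) _ zj).
by rewrite inE facet_ptF orbT.
Qed.

(** The boundary of the simplex [B] is recovered from its coordinates, whatever
    their scale. *)
Lemma retract_coords z (c : R) : nonneg z -> supported B z -> coords z != 0 ->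
  0 < c -> (forall j, -1 <= (c *: coords z) 0 j) ->
  retract (uncoords (c *: coords z)) = retract z.
Proof.
move=> z0 zB zN c0 w1; apply: (@retract_affine B card_cone z _ c (1 - c * z r)) => //.
- exact: uncoords_ge0.
- exact: uncoords_supported.
- exact: exceeds_level_coords.
move=> x xB; have [->|[j ->]] := coneP xB; first by rewrite uncoords_pt; ring.
by rewrite uncoords_vtx !mxE; ring.
Qed.

Lemma coords_retract z : nonneg z -> supported B z ->
  coords (retract z) = (\sum_x above_level z x)^-1 *: coords z.
Proof.
move=> z0 zB; apply/rowP => j; rewrite !mxE /retract.
rewrite !(above_level_supported card_cone _ z0 zB) facet_vtxB inE facet_ptF orbT.
by rewrite -mulrBl mulrC; congr (_ * _); ring.
Qed.

Lemma coords_push_apex p : min_on F p = 0 ->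
  coords (push (min_on F p) 1 p) = delta_mx 0 0.
Proof.
move=> m0; apply/rowP => j; rewrite !mxE /push m0.
have -> : (r == x0) = false by apply: contraTF facet_ptF => /eqP ->.
have -> : (v j == x0) = (j == 0) by rewrite -[X in _ == X]facet_vtx0 (inj_eq facet_vtx_inj).
by rewrite eqxx /=; ring.
Qed.

Lemma push_supported m t p : supp p \subset B -> supported B (push m t p).
Proof.
move=> /fintype.subsetP pB x xB; rewrite /push.
have -> : p x = 0 by apply/eqP; have := contra (pB x) xB; rewrite inE negbK.
have -> : (x == x0) = false by apply: contraNF xB => /eqP ->; rewrite !inE eqxx.
by rewrite !mulr0 addr0.
Qed.

End Facet.
End Retraction.

(** * Projection to the Euclidean sphere *)

Section Euclid.
Variables (R : realType) (n : nat).
Implicit Types w : 'rV[R]_n.+1.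

Definition enorm w : R := Num.sqrt (\sum_j w 0 j ^+ 2).

Definition normalize w : 'rV[R]_n.+1 := (enorm w)^-1 *: w.

Lemma enorm_gt0 w : w != 0 -> 0 < enorm w.
Proof.
move=> w0; rewrite sqrtr_gt0 lt_neqAle sumr_ge0 ?andbT; last first.
  by move=> j _; apply: sqr_ge0.
rewrite eq_sym psumr_eq0; last by move=> j _; apply: sqr_ge0.
apply: contra w0 => /allP w0; apply/eqP/rowP => j; rewrite mxE; apply/eqP.
by have := w0 j (mem_index_enum j); rewrite /= sqrf_eq0.
Qed.

Lemma normalize_sphere w : w != 0 -> \sum_j normalize w 0 j ^+ 2 = 1.
Proof.
move=> w0; under eq_bigr do rewrite mxE exprMn.
have e0 := enorm_gt0 w0.
rewrite -mulr_sumr -[X in _ * X]sqr_sqrtr ?sumr_ge0 // => [|j _]; last exact: sqr_ge0.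
by rewrite -exprMn mulVf ?expr1n // gt_eqF.
Qed.

Lemma enorm_sphere w : \sum_j w 0 j ^+ 2 = 1 -> enorm w = 1.
Proof. by rewrite /enorm => ->; apply: sqrtr1. Qed.

Lemma enormZ (c : R) w : 0 <= c -> enorm (c *: w) = c * enorm w.
Proof.
move=> c0; rewrite /enorm; under eq_bigr do rewrite mxE exprMn.
by rewrite -mulr_sumr sqrtrM ?sqr_ge0 // sqrtr_sqr ger0_norm.
Qed.

Lemma normalize_scale (c : R) w : 0 < c -> \sum_j w 0 j ^+ 2 = 1 ->
  normalize (c *: w) = w.
Proof.
move=> c0 w1; rewrite /normalize enormZ ?ltW // (enorm_sphere w1) mulr1.
by rewrite scalerA mulVf ?scale1r // gt_eqF.
Qed.

Lemma normalize_delta : normalize (delta_mx 0 0) = delta_mx 0 0.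
Proof.
rewrite -[X in normalize X]scale1r normalize_scale //.
rewrite (bigD1 ord0) //= mxE !eqxx expr1n big1 ?addr0 // => j /negbTE j0.
by rewrite mxE j0 expr0n.
Qed.

Lemma sphere_coord_ge w j : \sum_j w 0 j ^+ 2 = 1 -> -1 <= w 0 j.
Proof.
move=> w1; have : w 0 j ^+ 2 <= 1.
  by rewrite -w1 (bigD1 j) //= lerDl sumr_ge0 // => i _; apply: sqr_ge0.
by rewrite expr2; nra.
Qed.

Lemma sphere_neq0 w : \sum_j w 0 j ^+ 2 = 1 -> w != 0.
Proof.
move=> w1; apply: contra_eq_neq w1 => ->.
by rewrite big1 ?(eq_sym 0) ?oner_eq0 // => j _; rewrite mxE expr0n.
Qed.

End Euclid.

(** * Continuity *)

Module SkeletonHomotopy.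
From mathcomp Require Import all_classical all_reals all_analysis homotopy.
Import numFieldNormedType.Exports.
Local Open Scope classical_set_scope.

Section Real.
Context {R : realType} {T : topologicalType}.
Implicit Types f g : T -> R.

Lemma cts_cst (c : R) : continuous (fun _ : T => c).
Proof. by move=> x; apply: cvg_cst. Qed.

Lemma ctsD f g : continuous f -> continuous g -> continuous (fun x => f x + g x).
Proof. by move=> cf cg x; apply: cvgD; [apply: cf|apply: cg]. Qed.

Lemma ctsB f g : continuous f -> continuous g -> continuous (fun x => f x - g x).
Proof. by move=> cf cg x; apply: cvgB; [apply: cf|apply: cg]. Qed.

Lemma ctsM f g : continuous f -> continuous g -> continuous (fun x => f x * g x).
Proof. by move=> cf cg x; apply: cvgM; [apply: cf|apply: cg]. Qed.

Lemma ctsV f : (forall x, f x != 0) -> continuous f ->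
  continuous (fun x => (f x)^-1).
Proof. by move=> f0 cf x; apply: cvgV => //; apply: cf. Qed.

Lemma cts_max f g : continuous f -> continuous g ->
  continuous (fun x => Num.max (f x) (g x)).
Proof. by move=> cf cg x; apply: continuous_max; [apply: cf|apply: cg]. Qed.

Lemma cts_min f g : continuous f -> continuous g ->
  continuous (fun x => Num.min (f x) (g x)).
Proof. by move=> cf cg x; apply: continuous_min; [apply: cf|apply: cg]. Qed.

Lemma cts_sqrt f : continuous f -> continuous (fun x => Num.sqrt (f x)).
Proof.
by move=> cf x; apply: continuous_comp; [apply: cf|apply: sqrt_continuous].
Qed.

End Real.

Lemma cts_big {R : realType} {T : topologicalType} (op : R -> R -> R)
    (idx : T -> R) (I : Type) (r : seq I) (P : pred I) (F : I -> T -> R) :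
  (forall f g : T -> R, continuous f -> continuous g ->
     continuous (fun x => op (f x) (g x))) ->
  continuous idx -> (forall i, P i -> continuous (F i)) ->
  continuous (fun x => \big[op/idx x]_(i <- r | P i) F i x).
Proof.
move=> cop cidx cF; elim: r => [|i r IHr].
  have -> : (fun x => \big[op/idx x]_(i <- [::] | P i) F i x) = idx; last by [].

  by apply/funext => x; rewrite big_nil.
rewrite [X in continuous X](_ : _ = fun x => if P i then
  op (F i x) (\big[op/idx x]_(j <- r | P j) F j x) else
  \big[op/idx x]_(j <- r | P j) F j x); last first.
  by apply/funext => x; rewrite big_cons.
by case: (P i) (cF i) => // cFi; apply: cop => //; apply: cFi.
Qed.

Lemma cts_prod_topology {T : topologicalType} (I : eqType)
    (K : I -> topologicalType) (f : T -> prod_topology K) :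
  (forall i, continuous (fun t => f t i)) -> continuous f.
Proof.
move=> cf t; apply/cvg_sup => i; apply: cvg_trans; last exact: cvg_id.
have := @continuous_comp_initial _ _ _ (@^~ i) f.
exact.
Qed.

Lemma cts_rV {R : realType} {T : topologicalType} n (f : T -> 'rV[R]_n) :
  (forall j, continuous (fun t => f t 0 j)) -> continuous f.
Proof.
move=> cf t U [P fP PU]; rewrite nbhs_simpl /=.
have near_f i : nbhs t (fun t' => forall j, P i j (f t' i j)).
  apply: filter_forall => j; move: (fP i j); rewrite !ord1; exact: cf.
have : nbhs t (fun t' => forall i j, P i j (f t' i j)) by apply: filter_forall.
by apply: filterS => t' ?; apply: PU.
Qed.

Lemma cts_rV_coord {R : realType} {T : topologicalType} n (f : T -> 'rV[R]_n) j :
  continuous f -> continuous (fun t => f t 0 j).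
Proof.
move=> cf t; apply: (@continuous_comp _ _ _ f (fun M : 'rV_n => M 0 j)).
  exact: cf.
exact: coord_continuous.
Qed.

Definition corestrict {T : Type} {V : topologicalType} (A : set V) (f : T -> V)
  (fA : forall t, A (f t)) (t : T) : A := exist _ (f t) (mem_set (fA t)).

Lemma cts_corestrict {T V : topologicalType} (A : set V) (f : T -> V)
  (fA : forall t, A (f t)) : continuous f -> continuous (corestrict fA).
Proof. by move=> cf; apply: continuous_comp_initial. Qed.

Lemma cts_set_val {T V : topologicalType} (A : set V) (f : T -> A) :
  continuous f -> continuous (fun t => set_val (f t)).
Proof.
by move=> cf t; apply: continuous_comp; [apply: cf|apply: initial_continuous].
Qed.

Section Wedge.
Context {I : choiceType} (X : I -> topologicalType) (p0 : forall i, X i).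
Hypothesis finI : finite_set [set: I].
Hypothesis closed_p0 : forall i, closed [set p0 i].

(** A finite wedge carries the topology induced by the product, so continuity into
    it may be tested coordinatewise.  This avoids gluing maps that are defined
    piecewise on the source. *)
Lemma cts_into_wedge {T : topologicalType} (f : T -> wedge p0) :
  (forall i, continuous (fun t => wedge_prod (f t) i)) -> continuous f.
Proof.
move=> cf t A Aft.
have /nbhs_subspace_ex[] := wedge_prod_open finI closed_p0 Aft; first by exists (f t).
move=> V nV AV.
have fV : nbhs t ((fun t => wedge_prod (f t)) @^-1` V) by exact: cts_prod_topology cf _ _ nV.
apply: (filterS _ fV) => t' /= Vft'.
have : (V `&` range (wedge_prod (p0 := p0))) (wedge_prod (f t')) by split; [|exists (f t')].
rewrite -AV => -[[a Aa /(@wedge_prod_inj _ _ p0) <-] _] //.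
Qed.

End Wedge.

Lemma closed_set1_subset {R : realType} (V : normedModType R) (A : set V) (a : A) :
  closed [set a].
Proof.
rewrite (_ : [set a] = set_val @^-1` [set set_val a]).
  apply: closed_comp => [x _|]; first exact: initial_continuous.
  exact/accessible_closed_set1/hausdorff_accessible/norm_hausdorff.
rewrite eqEsubset; split=> [x -> //|x /= xa].
by apply: val_inj; rewrite -!set_valE.
Qed.

(** * Homotopy equivalence with a wedge of spheres *)

Lemma superset_of_card (T : finType) (A C : {set T}) n :
  A \subset C -> (#|A| <= n <= #|C|)%N ->
  exists F : {set T}, [/\ A \subset F, F \subset C & #|F| = n].
Proof.
move=> AC /andP[An nC]; have [|D DC Dn] := @subset_of_card _ (C :\: A) (n - #|A|).
  by rewrite cardsD (finset.setIidPr AC) leq_sub2r.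
exists (A :|: D); split; first exact: finset.subsetUl.
  by rewrite finset.subUset AC (fintype.subset_trans DC) // finset.subsetDl.
rewrite cardsU disjoint_setI0 ?cards0 ?subn0 ?Dn ?subnKC //.
by rewrite fintype.disjoint_sym; move: DC; rewrite finset.subsetD => /andP[].
Qed.

Section Maps.
Context {R : realType} {T : topologicalType} {X : finType} (k : nat).
Implicit Types (Z : T -> X -> R).

Lemma cts_min_on (A : {set X}) Z : (forall x, continuous (Z^~ x)) ->
  continuous (fun t => min_on A (Z t)).
Proof.
move=> cZ; apply: cts_big => //; first exact: cts_min.
apply: (@cts_big _ _ +%R (fun=> 0)) => //; [exact: ctsD|exact: cts_cst].
Qed.

Lemma cts_sum Z : (forall x, continuous (Z^~ x)) ->
  continuous (fun t => \sum_x Z t x).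
Proof.
move=> cZ; apply: (@cts_big _ _ +%R (fun=> 0)) => //; [exact: ctsD|exact: cts_cst].
Qed.

Lemma cts_above_level Z x : (forall x, continuous (Z^~ x)) ->
  continuous (fun t => above_level k (Z t) x).
Proof.
move=> cZ; apply: cts_max; first exact: cts_cst.
apply: ctsB; first exact: cZ.
apply: (@cts_big _ _ Num.max (fun=> 0)); [exact: cts_max|exact: cts_cst|].
by move=> A _; apply: cts_min_on.
Qed.

Lemma cts_retract Z x : (forall t, exceeds_level k (Z t)) ->
  (forall x, continuous (Z^~ x)) -> continuous (fun t => retract k (Z t) x).
Proof.
move=> ndZ cZ; apply: ctsM; first exact: cts_above_level.
apply: ctsV => [t|]; first by rewrite gt_eqF // sum_above_level_gt0.
by apply: (@cts_sum (fun t => above_level k (Z t))) => y; apply: cts_above_level.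
Qed.

Lemma cts_push (x0 : X) (m s : T -> R) Z x : continuous m -> continuous s ->
  (forall x, continuous (Z^~ x)) ->
  continuous (fun t => push k x0 (m t) (s t) (Z t) x).
Proof.
move=> cm cs cZ; apply: ctsD; last first.
  apply: ctsM; last exact: cts_cst.
  apply: ctsM => //; apply: ctsB; first exact: cts_cst.
  by apply: ctsM => //; exact: cts_cst.
apply: ctsM => //; apply: ctsD; last exact: ctsM.
by apply: ctsB => //; exact: cts_cst.
Qed.

Lemma cts_coords x0 (F : {set X}) Z : (forall x, continuous (Z^~ x)) ->
  continuous (fun t => coords k x0 F (Z t)).
Proof.
move=> cZ; apply: cts_rV => j.
rewrite [X in continuous X](_ : _ = fun t =>
  Z t (facet_vtx x0 F j) - Z t (facet_pt x0 F)); last first.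
  by apply/funext => t; rewrite mxE.
by apply: ctsB.
Qed.

Lemma cts_uncoords x0 (F : {set X}) (w : T -> 'rV[R]_k.+1) x : continuous w ->
  continuous (fun t => uncoords x0 F (w t) x).
Proof.
move=> cw; rewrite /uncoords; case: (x \in _); last exact: cts_cst.
apply: ctsD; first exact: cts_cst.
apply: (@cts_big _ _ +%R (fun=> 0)); [exact: ctsD|exact: cts_cst|].
move=> j _; apply: ctsM; [exact: cts_cst|exact: cts_rV_coord].
Qed.

Lemma cts_normalize n (w : T -> 'rV[R]_n.+1) : (forall t, w t != 0) ->
  continuous w -> continuous (fun t => normalize (w t)).
Proof.
move=> w0 cw; apply: cts_rV => j.
rewrite [X in continuous X](_ : _ = fun t => (enorm (w t))^-1 * w t 0 j); last first.
  by apply/funext => t; rewrite mxE.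
apply: ctsM; last exact: cts_rV_coord.
apply: ctsV => [t|]; first by rewrite gt_eqF // enorm_gt0.
apply: cts_sqrt; apply: (@cts_big _ _ +%R (fun=> 0)); [exact: ctsD|exact: cts_cst|].
move=> i _; rewrite [X in continuous X](_ : _ = fun t => w t 0 i * w t 0 i).
  by apply: ctsM; exact: cts_rV_coord.
by apply/funext => t; rewrite expr2.
Qed.

End Maps.

Section Skeleton.
Variables (R : realType) (X : finType) (k : nat) (S : {set {set X}}) (x0 : X).
Hypothesis faceS : forall F : {set X}, (F \in S) = (#|F| <= k.+1)%N.
Hypothesis cardX : (k.+2 <= #|X|)%N.

Local Notation Y := (geometric_realization R S).
Local Notation sph := (sphere R k).

(** There is one sphere for each of these sets: the boundary of the simplex spanned
    by the set and [x0]. *)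
Definition far_facets : {set {set X}} :=
  [set F : {set X} | (F \subset [set~ x0]%SET) && (#|F| == k.+1)]%SET.

Lemma card_far_facets : #|far_facets| = 'C(#|X|.-1, k.+1).
Proof. by rewrite cards_draws cardsC1. Qed.

Local Notation I := 'I_#|far_facets|.
Definition facet (i : I) : {set X} := enum_val i.
Implicit Types (i : I) (y : Y) (w : sph) (p : X -> R).

Lemma facet_inj : injective facet. Proof. exact: enum_val_inj. Qed.

Lemma x0_facet i : x0 \notin facet i.
Proof.
have := enum_valP i; rewrite inE => /andP[/fintype.subsetP sF _].
by apply/negP => /sF; rewrite !inE eqxx.
Qed.

Lemma card_facet i : #|facet i| = k.+1.
Proof. by have := enum_valP i; rewrite inE => /andP[_ /eqP]. Qed.

Lemma facet_pt_in i : facet_pt x0 (facet i) \in facet i.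
Proof. exact: facet_ptF (card_facet i). Qed.

Lemma facet_pt_neq i : (facet_pt x0 (facet i) == x0) = false.
Proof. by apply: contraNF (x0_facet i) => /eqP <-; apply: facet_pt_in. Qed.

Lemma facet_vtx_eq i (j : 'I_k.+1) : (facet_vtx x0 (facet i) j == x0) = (j == 0).
Proof.
rewrite -[X in _ == X](facet_vtx0 k x0 (facet i)).
by rewrite (inj_eq (facet_vtx_inj (x0_facet i) (card_facet i))).
Qed.

Lemma facet_ex (A : {set X}) : (#|A| <= k.+1)%N -> exists i, A \subset x0 |: facet i.
Proof.
move=> Ak; have [||F [AF Fx0 Fk]] := @superset_of_card _ (A :\ x0) [set~ x0]%SET k.+1.
- by apply/fintype.subsetP => x; rewrite !inE => /andP[].
- rewrite (leq_trans _ Ak) ?subset_leq_card ?finset.subD1set //= cardsC1.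
  by rewrite -ltnS prednK // (leq_trans _ cardX).
have FF : F \in far_facets by rewrite inE Fx0 Fk eqxx.
exists (enum_rank_in FF F); rewrite /facet enum_rankK_in //.
by rewrite -subDset.
Qed.

Definition point_of y : X -> R := set_val y.

Lemma point_ofP y : simplex_point k (point_of y).
Proof.
have := set_valP y; rewrite /point_of; case=> p0 p1 pS; split=> //.
by rewrite -faceS.
Qed.

Lemma cts_point_of (T : topologicalType) (f : T -> Y) x :
  continuous f -> continuous (fun t => point_of (f t) x).
Proof.
move=> cf t; apply: (@continuous_comp _ _ _ (fun t => set_val (f t))
  (fun p : {ptws X -> R} => p x)); first exact: cts_set_val.
exact: (@proj_continuous X (fun=> R) x).
Qed.

Lemma realization_point (p : X -> R) (ps : simplex_point k p) :
  [set p : {ptws X -> R} |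
    [/\ forall x, 0 <= p x, \sum_x p x = 1 & supp p \in S]] p.
Proof. by case: ps => p0 p1 pk; split=> //; rewrite faceS. Qed.

Definition to_realization (T : Type) (f : T -> X -> R)
    (fP : forall t, simplex_point k (f t)) : T -> Y :=
  corestrict (fun t => realization_point (fP t)).

Lemma cts_to_realization (T : topologicalType) (f : T -> X -> R)
    (fP : forall t, simplex_point k (f t)) :
  (forall x, continuous (fun t => f t x)) -> continuous (to_realization fP).
Proof. by move=> cf; apply: cts_corestrict; apply: cts_prod_topology. Qed.

Lemma realization_eq y y' : (forall x, point_of y x = point_of y' x) -> y = y'.
Proof. by move=> yy; apply: val_inj; rewrite -!set_valE; apply/funext. Qed.

Lemma sphere_eq w w' : set_val w = set_val w' -> w = w'.
Proof. by move=> ww; apply: val_inj; rewrite -!set_valE. Qed.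

Local Notation facet_depth i p := (min_on (facet i) p).

(** Outside the interior of the facet this is the base point of the sphere, and in
    the interior the facet is stretched over the whole sphere. *)
Definition to_sphere_vec i p : 'rV[R]_k.+1 :=
  coords k x0 (facet i) (push k x0 (facet_depth i p) 1 p).

Lemma to_sphere_vec_neq0 i p : simplex_point k p -> to_sphere_vec i p != 0.
Proof.
move=> ps; apply: coords_neq0; first exact: card_facet.
by apply: push_nonconst => //; [exact: x0_facet|exact: card_facet|rewrite ler01 lexx|left].
Qed.

Definition to_sphere i : Y -> sph :=
  @corestrict _ _ (sphere_set R k) (fun y => normalize (to_sphere_vec i (point_of y)))
   (fun y => normalize_sphere (to_sphere_vec_neq0 i (point_ofP y))).

Lemma cts_to_sphere i : continuous (to_sphere i).
Proof.
apply: cts_corestrict; apply: cts_normalize => [y|].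
  exact/to_sphere_vec_neq0/point_ofP.
have cp x : continuous (fun y => point_of y x).
  by apply: (@cts_point_of _ id) => y; apply: cvg_id.
apply: cts_coords => x; apply: cts_push => //; last exact: cts_cst.
exact: cts_min_on.
Qed.

Lemma to_sphere_base i y : facet_depth i (point_of y) = 0 -> to_sphere i y = sphere_base R k.
Proof.
move=> r0; apply: sphere_eq; rewrite !set_valE /= /to_sphere_vec.
rewrite (coords_push_apex (x0_facet i) (card_facet i) r0).
exact: normalize_delta.
Qed.

(** Positive depth in a facet means that [p] is interior to that facet; so at most
    one of the depths is nonzero, and the maximum in [depth] only selects it. *)
Lemma facet_depth_other i j p : simplex_point k p -> supp p \subset x0 |: facet i ->
  j != i -> facet_depth j p = 0.
Proof.
move=> ps pi ji; apply/eqP; apply: contraNT ji => rj.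
have rj0 : 0 < facet_depth j p by rewrite lt_neqAle eq_sym rj min_on_ge0 //; case: ps.
have sj := min_on_gt0_supp (card_facet j) ps rj0.
apply/eqP/facet_inj/eqP; rewrite eqEcard !card_facet leqnn andbT.
apply/fintype.subsetP => x xj; have := fintype.subsetP pi x.
rewrite sj xj !inE => /(_ isT)/predU1P[xx0|//].
by have := x0_facet j; rewrite -xx0 xj.
Qed.

Definition depth p : R := \big[Num.max/0]_i facet_depth i p.

Lemma depthE i p : simplex_point k p -> supp p \subset x0 |: facet i ->
  depth p = facet_depth i p.
Proof.
move=> ps pi; apply/le_anti; rewrite (le_bigmax_cond _ (fun i => facet_depth i p)) // andbT.
have r0 : 0 <= facet_depth i p by apply: min_on_ge0; case: ps.
apply: bigmax_le => // j _; have [->//|ji] := eqVneq j i.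
by rewrite (facet_depth_other ps pi ji).
Qed.

Lemma carrier_ex y : exists i, supp (point_of y) \subset x0 |: facet i.
Proof. by apply: facet_ex; have [] := point_ofP y. Qed.

Definition carrier y : I := projT1 (cid (carrier_ex y)).

Local Notation W := (wedge (fun _ : I => sphere_base R k)).

Local Notation inS i := (@wedge_lift I (fun=> sph) (fun=> sphere_base R k) i).

Lemma inS_base i j : inS i (sphere_base R k) = inS j (sphere_base R k).
Proof.
pose b := sphere_base R k.
exact: (@wedge_liftE _ _ (fun=> b) j b i b).
Qed.

(** Every point of the skeleton lies in the cone over some facet; by [collapseE]
    it does not matter which one is chosen. *)
Definition collapse y : W :=
  inS (carrier y) (to_sphere (carrier y) y).

Lemma collapseE i y : supp (point_of y) \subset x0 |: facet i ->
  collapse y = inS i (to_sphere i y).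
Proof.
move=> yi; rewrite /collapse; have yc := projT2 (cid (carrier_ex y)).
rewrite -/(carrier y) in yc.
have [->//|ci] := eqVneq (carrier y) i.
have rc := facet_depth_other (point_ofP y) yi ci; rewrite eq_sym in ci.
have ri := facet_depth_other (point_ofP y) yc ci.
by rewrite (to_sphere_base rc) (to_sphere_base ri); apply: inS_base.
Qed.

Lemma wedge_prod_collapse y i : wedge_prod (collapse y) i = to_sphere i y.
Proof.
rewrite /wedge_prod /collapse wedge_lift_funE; last exact: wedge_prod_pointE.
have [->|ci] := eqVneq (carrier y) i; first by rewrite dfwithin.
rewrite dfwithout // to_sphere_base //; rewrite eq_sym in ci.
exact: facet_depth_other (point_ofP y) (projT2 (cid (carrier_ex y))) ci.
Qed.

Lemma closed_sphere_base i : closed [set sphere_base R k].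
Proof. exact: closed_set1_subset. Qed.

Lemma cts_collapse : continuous collapse.
Proof.
apply: cts_into_wedge; [exact: finite_finset|exact: closed_sphere_base|move=> i].
rewrite [X in continuous X](_ : _ = to_sphere i); first exact: cts_to_sphere.
by apply/funext => y; apply: wedge_prod_collapse.
Qed.

Lemma uncoords_sphere i w :
  nonneg (uncoords x0 (facet i) (set_val w)) /\
  exceeds_level k (uncoords x0 (facet i) (set_val w)).
Proof.
have w1 : \sum_j set_val w 0 j ^+ 2 = 1 := set_valP w.
have z0 : nonneg (uncoords x0 (facet i) (set_val w)).
  apply: uncoords_ge0; [exact: x0_facet|exact: card_facet|].
  by move=> j; apply: sphere_coord_ge.
split=> //.
apply: (exceeds_level_coords (x0_facet i) (card_facet i) z0).
  exact: uncoords_supported.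
by rewrite coords_uncoords ?x0_facet ?card_facet // sphere_neq0.
Qed.

Definition from_sphere i : sph -> Y :=
  to_realization (fun w =>
    retract_simplex (proj1 (uncoords_sphere i w)) (proj2 (uncoords_sphere i w))).

Lemma cts_from_sphere i : continuous (from_sphere i).
Proof.
apply: cts_to_realization => x; apply: cts_retract => [w|y].
  by have [] := uncoords_sphere i w.
by apply: cts_uncoords; exact: initial_continuous.
Qed.

Lemma from_sphere_supp i w : supp (point_of (from_sphere i w)) \subset x0 |: facet i.
Proof.
apply/fintype.subsetP => x; rewrite inE; apply: contraNT => xB; apply/eqP.
have [z0 _] := uncoords_sphere i w.
rewrite /point_of /from_sphere set_valE /= /retract.
rewrite (above_level_supported (card_cone (x0_facet i) (card_facet i))) //.
  by rewrite (negbTE xB) mul0r.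
exact: uncoords_supported.
Qed.

Lemma from_sphere_base i x : point_of (from_sphere i (sphere_base R k)) x = (x == x0)%:R.
Proof.
(* the base point corresponds to the apex, up to a constant on the cone *)
pose a x : R := (x == x0)%:R.
have a0 : nonneg a by move=> z; rewrite ler0n.
have ap : simplex_point k a.
  split=> //.
    by rewrite (bigD1 x0) //= /a eqxx big1 ?addr0 // => z /negbTE ->.
  rewrite (_ : supp a = [set x0]%SET) ?cards1 //.
  apply/setP => z; rewrite !inE /a; case: (z == x0) => //; rewrite ?oner_eq0 ?eqxx //.
have asupp : supported (x0 |: facet i) a.
  by move=> z; rewrite !inE negb_or /a => /andP[/negbTE ->].
have [z0 _] := uncoords_sphere i (sphere_base R k).
have cB := card_cone (x0_facet i) (card_facet i).
rewrite /point_of /from_sphere set_valE /= (@retract_affine _ _ _ _ cB a _ 1 1) //.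
- by rewrite retract_id.
- exact: uncoords_supported.
- apply: (exceeds_level_supported cB (x := x0) (y := facet_pt x0 (facet i))) => //.
  + by rewrite !inE eqxx.
  + by rewrite !inE facet_pt_in orbT.
  + by rewrite /a eqxx facet_pt_neq oner_eq0.
- move=> z zB; have [->|[j ->]] := coneP (card_facet i) zB.
    rewrite uncoords_pt ?x0_facet ?card_facet // /a facet_pt_neq.
    by rewrite mulr0 add0r.
  rewrite uncoords_vtx ?x0_facet ?card_facet // /sphere_base /= mxE eqxx /=.
  by rewrite mul1r addrC /a facet_vtx_eq.
Qed.

Lemma from_sphere_baseE i j :
  from_sphere i (sphere_base R k) = from_sphere j (sphere_base R k).
Proof. by apply: realization_eq => x; rewrite !from_sphere_base. Qed.

Definition expand : W -> Y := wedge_fun from_sphere.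

Lemma cts_expand : continuous expand.
Proof. exact: wedge_fun_continuous cts_from_sphere from_sphere_baseE. Qed.

Lemma expand_lift i w :
  expand (inS i w) = from_sphere i w.
Proof. exact: wedge_lift_funE from_sphere_baseE. Qed.

(** The homotopies start at the composite maps, that is at [push] with parameter 1,
    and end at the identity.  Cutting the parameter off makes them continuous on
    the whole line. *)
Definition rev_clamp (t : R) : R := Num.min 1 (Num.max 0 (1 - t)).

Lemma rev_clamp01 t : 0 <= rev_clamp t <= 1.
Proof. by rewrite /rev_clamp ge_min lexx le_min ler01 le_max lexx. Qed.

Lemma rev_clamp0 : rev_clamp 0 = 1.
Proof. by rewrite /rev_clamp subr0 max_r // minxx. Qed.

Lemma rev_clamp1 : rev_clamp 1 = 0.
Proof. by rewrite /rev_clamp subrr maxxx min_r. Qed.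

Lemma cts_rev_clamp (T : topologicalType) :
  continuous (fun tx : R * T => rev_clamp tx.1).
Proof.
apply: cts_min; first exact: cts_cst.
apply: cts_max; first exact: cts_cst.
by apply: ctsB; [exact: cts_cst|move=> x; apply: cvg_fst].
Qed.

Lemma push_carrier t p i : simplex_point k p -> 0 <= t <= 1 ->
  supp p \subset x0 |: facet i ->
  nonneg (push k x0 (facet_depth i p) t p) /\
  exceeds_level k (push k x0 (facet_depth i p) t p).
Proof.
move=> ps t01 pi; have [p0 _ _] := ps.
have z0 : nonneg (push k x0 (facet_depth i p) t p).
  apply: push_ge0 => //; first exact: min_on_ge0.
  exact: (card_min_on_le1 (card_facet i) ps).
split=> //; have [|x xF zx] := push_nonconst (x0_facet i) (card_facet i) ps t01.
  by right.
apply: (exceeds_level_supported _ z0 _ _ _ zx).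
- exact: (card_cone (x0_facet i) (card_facet i)).
- exact: push_supported.
- by rewrite !inE xF orbT.
- by rewrite !inE eqxx.
Qed.

(** The segment from [p] to its pushed point leaves the skeleton through the
    interior of the cone; [retract] projects it back to the boundary. *)
Definition skeleton_path (ty : R * Y) : X -> R :=
  push k x0 (depth (point_of ty.2)) (rev_clamp ty.1) (point_of ty.2).

Lemma skeleton_pathP ty : nonneg (skeleton_path ty) /\ exceeds_level k (skeleton_path ty).
Proof.
have [i ip] := carrier_ex ty.2; have ps := point_ofP ty.2.
rewrite /skeleton_path (depthE ps ip); exact: (push_carrier ps (rev_clamp01 _) ip).
Qed.

Definition skeleton_homotopy : R * Y -> Y :=
  to_realization (fun ty => retract_simplex (proj1 (skeleton_pathP ty)) (proj2 (skeleton_pathP ty))).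

Lemma cts_skeleton_homotopy : continuous skeleton_homotopy.
Proof.
have cp x : continuous (fun ty : R * Y => point_of ty.2 x).
  by apply: cts_point_of => y; apply: cvg_snd.
apply: cts_to_realization => x; apply: cts_retract => [ty|y].
  by have [] := skeleton_pathP ty.
apply: cts_push => //; last exact: cts_rev_clamp.
apply: (@cts_big _ _ Num.max (fun=> 0)); [exact: cts_max|exact: cts_cst|].
by move=> i _; apply: (@cts_min_on _ _ _ _ (fun ty : R * Y => point_of ty.2)).
Qed.

Lemma skeleton_homotopy0 y : skeleton_homotopy (0, y) = expand (collapse y).
Proof.
have [i iy] := carrier_ex y; have ps := point_ofP y.
rewrite (collapseE iy) expand_lift; apply: realization_eq => x.
rewrite /point_of /skeleton_homotopy /from_sphere !set_valE /= /skeleton_path /= rev_clamp0.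
rewrite (depthE ps iy).
have v0 := to_sphere_vec_neq0 i ps.
have [z0 _] := push_carrier ps (rev_clamp01 0) iy; rewrite rev_clamp0 in z0.
rewrite retract_coords //; [exact: x0_facet|exact: card_facet|exact: push_supported| |].
  by rewrite invr_gt0 enorm_gt0.
by move=> j; apply: sphere_coord_ge; apply: normalize_sphere.
Qed.

Lemma skeleton_homotopy1 y : skeleton_homotopy (1, y) = y.
Proof.
apply: realization_eq => x; rewrite {1}/point_of /skeleton_homotopy set_valE /= /skeleton_path /=.
by rewrite rev_clamp1 push0 retract_id //; apply: point_ofP.
Qed.

(** The same push, read in the coordinates of a single sphere. *)
Definition sphere_path i (tw : R * sph) : 'rV[R]_k.+1 :=
  let p := point_of (from_sphere i tw.2) in
  coords k x0 (facet i) (push k x0 (facet_depth i p) (rev_clamp tw.1) p).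

Lemma sphere_path_neq0 i tw : sphere_path i tw != 0.
Proof.
apply: coords_neq0; first exact: card_facet.
apply: (push_nonconst (x0_facet i) (card_facet i) (point_ofP _) (rev_clamp01 _)).
by right; apply: from_sphere_supp.
Qed.

Definition sphere_homotopy i : R * sph -> sph :=
  @corestrict _ _ (sphere_set R k) (fun tw => normalize (sphere_path i tw))
   (fun tw => normalize_sphere (sphere_path_neq0 i tw)).

Lemma cts_sphere_homotopy i : continuous (sphere_homotopy i).
Proof.
have cp x : continuous (fun tw : R * sph => point_of (from_sphere i tw.2) x).
  apply: cts_point_of => tw; apply: (@continuous_comp _ _ _ snd (from_sphere i)).
    exact: cvg_snd.
  exact: cts_from_sphere.
apply: cts_corestrict; apply: cts_normalize; first exact: sphere_path_neq0.
apply: cts_coords => x; apply: cts_push => //; last exact: cts_rev_clamp.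
exact: cts_min_on.
Qed.

Lemma sphere_homotopy0 i w : sphere_homotopy i (0, w) = to_sphere i (from_sphere i w).
Proof. by apply: sphere_eq; rewrite !set_valE /= /sphere_path rev_clamp0. Qed.

Lemma sphere_homotopy1 i w : sphere_homotopy i (1, w) = w.
Proof.
apply: sphere_eq; rewrite set_valE /= /sphere_path rev_clamp1 push0 /=.
have [z0 zN] := uncoords_sphere i w.
rewrite /point_of /from_sphere set_valE /= coords_retract ?x0_facet ?card_facet //.
rewrite coords_uncoords ?x0_facet ?card_facet // normalize_scale //.
  by rewrite invr_gt0 sum_above_level_gt0.
exact: set_valP w.
exact: uncoords_supported.
Qed.

Lemma sphere_homotopy_base i t : sphere_homotopy i (t, sphere_base R k) = sphere_base R k.
Proof.
apply: sphere_eq; rewrite set_valE /= /sphere_path /=.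
have pE : point_of (from_sphere i (sphere_base R k)) = fun x => (x == x0)%:R.
  by apply/funext => x; apply: from_sphere_base.
have r0 : facet_depth i (fun x => (x == x0)%:R : R) = 0.
  apply: (@min_on_eq0 _ _ _ _ (facet_pt x0 (facet i))).
  - by move=> x; rewrite ler0n.
  - exact: facet_pt_in.
  - by rewrite facet_pt_neq.
rewrite pE r0 [coords _ _ _ _](_ : _ = delta_mx 0 0) ?normalize_delta //.
apply/rowP => j; rewrite !mxE /push facet_pt_neq facet_vtx_eq eqxx /=.
by ring.
Qed.

Definition wedge_homotopy : R * W -> W :=
  uncurry (fun t => wedge_fun (fun i w =>
    inS i (sphere_homotopy i (t, w)))).

Lemma wedge_homotopy_base t i j :
  inS i (sphere_homotopy i (t, sphere_base R k)) =
  inS j (sphere_homotopy j (t, sphere_base R k)).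
Proof. by rewrite !sphere_homotopy_base; apply: inS_base. Qed.

Lemma cts_wedge_homotopy : continuous wedge_homotopy.
Proof.
apply: (@wedge_fun_joint_continuous I (fun=> sph) (fun=> sphere_base R k) R W
  (fun i t w => wedge_lift (fun=> sphere_base R k) (sphere_homotopy i (t, w)))).
- exact: finite_finset.
- exact: closed_sphere_base.
- by move=> t i j; apply: wedge_homotopy_base.
- move=> i; rewrite [X in continuous X](_ : _ =
    inS i \o sphere_homotopy i).
    move=> tw; apply: continuous_comp; first exact: cts_sphere_homotopy.
    exact: wedge_lift_continuous.
  by apply/funext => -[].
Qed.

Lemma wedge_ind (P : W -> Prop) :
  (forall i w, P (inS i w)) ->
  forall u, P u.
Proof.
move=> PW u; have : [set: W] u by [].
by rewrite -wedgeTE => -[i _ [w _ <-]].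
Qed.

Lemma wedge_homotopy_lift t i w :
  wedge_homotopy (t, inS i w) =
  inS i (sphere_homotopy i (t, w)).
Proof. by rewrite /wedge_homotopy /= wedge_lift_funE //; apply: wedge_homotopy_base. Qed.

(** Both homotopies are the identity at time 1, and at time 0 they are the composites
    of [collapse] and [expand] because [from_sphere] inverts the passage to
    coordinates up to the radial projections. *)
Theorem skeleton_homotopy_wedge : homotopy_equivalent R Y W.
Proof.
exists collapse, expand; split.
- exact: cts_collapse.
- exact: cts_expand.
- exists skeleton_homotopy; split; [|exact: skeleton_homotopy0|exact: skeleton_homotopy1].
  exact/continuous_subspaceT/cts_skeleton_homotopy.
- exists wedge_homotopy; split; first exact/continuous_subspaceT/cts_wedge_homotopy.
    apply: wedge_ind => i w; rewrite wedge_homotopy_lift sphere_homotopy0 /= expand_lift.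
    by rewrite (@collapseE i) //; apply: from_sphere_supp.
  by apply: wedge_ind => i w; rewrite wedge_homotopy_lift sphere_homotopy1.
Qed.

End Skeleton.

End SkeletonHomotopy.

Theorem theorem6 (R : realType) (K : fieldType) (X : finType) (e : rel X)
    (k : int) :
  symmetric e -> irreflexive e -> chordal e ->
  (2 <= #|facets (clique_complex e)|)%N ->
  let Delta := clique_complex e in
  let Dual := alexander_dual Delta in
  let N : int := #|X|%:Z in
  let nmax : int := (\max_(F in facets Delta) #|F|)%N%:Z in
  -1 <= k -> k < N - 3 ->
  (skeleton Dual k = skeleton (full_simplex X) k <-> k <= N - nmax - 2) /\
  (k <= N - nmax - 2 ->
     (forall i : nat, (1 <= i)%N ->
        betti (SR_ideal (K := K) (skeleton Dual k)) i (i%:Z + k + 1) =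
        (binz N (i%:Z + k + 1) * binz (i%:Z + k) (k + 1))%N) /\
     (0 <= k ->
        homotopy_equivalent R
          (geometric_realization R (skeleton Dual k))
          (sphere_wedge R (binz (N - 1) (k + 1)) `|k|%N))).
Proof.
move=> _ _ _ facets2 Delta Dual N nmax k_ge k_lt.
have D0 : facets Delta != set0 by rewrite -card_gt0; apply: leq_trans facets2.
(* n = k + 1 is the largest cardinality of a face of the k-skeleton *)
have [n kE] : exists n : nat, k = n%:Z - 1 by exists (absz (k + 1)); lia.
have full : skeleton Dual k = skeleton (full_simplex X) k <-> k <= N - nmax - 2.
  rewrite kE dual_skeleton_full // /nmax -/(max_facet_card _) /N; lia.
split=> // /full ->; rewrite {k}kE in k_ge k_lt full *.
split=> [[//|i] _|].
  have -> : i.+1%:Z + (n%:Z - 1) + 1 = (i + n.+1)%N%:Z by lia.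
  have -> : i.+1%:Z + (n%:Z - 1) = (i + n)%N%:Z by lia.
  have -> : n%:Z - 1 + 1 = n%:Z by lia.
  rewrite (@SquarefreeVeronese.betti_SR_ideal _ _ _ n.+1) // => [|A]; last first.
    by rewrite mem_skeleton_full ltnNge.
  rewrite /SquarefreeVeronese.sqfree_rank /= addnS /=; congr (_ * _)%N.
  by rewrite -[RHS]bin_sub ?leq_addl // addnK.
case: n => [|n] in k_ge k_lt full *; first by lia.
move=> _; have -> : `|n.+1%:Z - 1|%N = n by lia.
have NX : (n.+2 < #|X|)%N by move: k_lt; rewrite /N; lia.
have [x0 _] : exists x0, x0 \in X by apply/card_gt0P; apply: leq_trans NX.
have -> : binz (N - 1) (n.+1%:Z - 1 + 1) = #|SkeletonHomotopy.far_facets n x0|.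
  rewrite SkeletonHomotopy.card_far_facets /N.
  have -> : n.+1%:Z - 1 + 1 = n.+1%:Z by lia.
  by have -> : #|X|%:Z - 1 = #|X|.-1%:Z by lia.
apply: SkeletonHomotopy.skeleton_homotopy_wedge => [F|]; first exact: mem_skeleton_full.
exact: ltnW.
Qed.
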